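(* Let $D=(d_1,\dots,d_n)\in\mathcal D^n$ be a dataset and let $f:\mathbb R^p\times\mathcal D\to\mathbb R$ be convex and continuously differentiable in its first argument, with $\|\nabla f(x,d)\|_2\le C$ for all $x\in\mathbb R^p$ and $d\in\mathcal D$, for some constant $C>0$. Fix $\lambda>0$, $\rho>0$, a mini-batch size $m\in\{1,\dots,n\}$, a number of iterations $T$, learning rates $\eta^0,\dots,\eta^{T-1}>0$, a noise level $\sigma>0$, and data-independent initial vectors $x^0,z^0,y^0\in\mathbb R^p$. Consider the randomized algorithm (ssADMM) which, for $k=0,1,\dots,T-1$: (i) samples a mini-batch $B_k$ of $m$ records from $D$ uniformly at random without replacement; (ii) computes $g_k=\frac1m\sum_{d\in B_k}\nabla f(x^k,d)$ and $\tilde g_k=g_k+\gamma_k$ with $\gamma_k\sim\mathcal N(0,\sigma^2 I_p)$ drawn independently; (iii) sets $x^{k+1}=\frac{1}{\rho+1/\eta^k}\left(-\tilde g_k-y^k+\rho z^k+x^k/\eta^k\right)$; (iv) sets $z^{k+1}=\mathcal S_{\lambda/\rho}(x^{k+1}+y^k/\rho)$, where $\mathcal S_t$ is the coordinatewise soft-thresholding operator $\mathcal S_t(w)_i=w_i-t$ if $w_i>t$, $w_i+t$ if $w_i<-t$, and $0$ otherwise; (v) sets $y^{k+1}=y^k+\rho(x^{k+1}-z^{k+1})$; and finally outputs $x^T$. Let $q=m/n$, and for integers $j\ge 2$ let $\epsilon(j)=\frac{j\,(2C/m)^2}{2\sigma^2}$. For integer $\alpha\ge2$ define $$\epsilon'(\alpha)=\frac{1}{\alpha-1}\log\Big(1+q^2\binom{\alpha}{2}\min\{4(e^{\epsilon(2)}-1),\,2e^{\epsilon(2)}\}+\sum_{j=3}^{\alpha}q^j\binom{\alpha}{j}2e^{(j-1)\epsilon(j)}\Big).$$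 Then for every integer $\alpha\ge 2$ this algorithm satisfies $(\alpha,\,T\epsilon'(\alpha))$-Rényi differential privacy.
   Context: Two datasets $D,D'\in\mathcal D^n$ are neighboring ($D\sim D'$) if $D'$ is obtained from $D$ by replacing one record with another element of $\mathcal D$. For $\alpha\in(1,\infty)$, the Rényi divergence of distributions $P,Q$ is $D_\alpha(P\|Q)=\frac{1}{\alpha-1}\log\mathbb E_{x\sim Q}\big[(P(x)/Q(x))^\alpha\big]$. A randomized mechanism $\mathcal M$ satisfies $(\alpha,\epsilon)$-Rényi differential privacy (RDP) if $D_\alpha(\mathcal M(D)\|\mathcal M(D'))\le\epsilon$ for every pair of neighboring datasets $D\sim D'$. *)

(* Defs.v *)
From HB Require Import structures.
From mathcomp Require Import all_boot all_order all_algebra.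
From mathcomp Require Import all_classical all_reals all_analysis.
Set Implicit Arguments.
Unset Strict Implicit.
Unset Printing Implicit Defensive.
Import Order.TTheory GRing.Theory Num.Theory.
Import numFieldNormedType.Exports.
Local Open Scope classical_set_scope.
Local Open Scope ring_scope.

Definition l2norm {R : realType} {p : nat} (w : 'rV[R]_p) : R :=
  Num.sqrt (\sum_(i < p) w ord0 i ^+ 2).

Definition gradient {R : realType} {p : nat} (g : 'rV[R]_p -> R)
    (x : 'rV[R]_p) : 'rV[R]_p :=
  \row_(i < p) 'D_(delta_mx ord0 i) g x.

Definition soft_threshold {R : realType} {p : nat} (t : R) (w : 'rV[R]_p)
    : 'rV[R]_p :=
  \row_(i < p) (if t < w ord0 i then w ord0 i - t
                else if w ord0 i < - t then w ord0 i + t else 0).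

(* The ssADMM algorithm as a deterministic function of its random     *)
(* inputs: the mini-batches (sets of record indices) Bs k and the     *)
(* Gaussian noise vectors gams k, k = 0 .. T-1.                        *)

Section ssADMM.
Context {R : realType} {Dom : Type} {n p : nat}.
Variables (f : 'rV[R]_p -> Dom -> R) (lam rho : R) (m : nat) (eta : nat -> R).

Definition ssadmm_step (D : 'I_n -> Dom) (k : nat) (B : {set 'I_n})
    (gam : 'rV[R]_p) (st : 'rV[R]_p * 'rV[R]_p * 'rV[R]_p)
    : 'rV[R]_p * 'rV[R]_p * 'rV[R]_p :=
  let: (x, z, y) := st in
  let g := (m%:R)^-1 *: \sum_(i in B) gradient (fun u => f u (D i)) x in
  let gt := g + gam in
  let x' := (rho + (eta k)^-1)^-1 *:
              (- gt - y + rho *: z + (eta k)^-1 *: x) in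
  let z' := soft_threshold (lam / rho) (x' + rho^-1 *: y) in
  let y' := y + rho *: (x' - z') in
  (x', z', y').

Fixpoint ssadmm_state (D : 'I_n -> Dom) (x0 z0 y0 : 'rV[R]_p)
    (Bs : nat -> {set 'I_n}) (gams : nat -> 'rV[R]_p) (k : nat)
    : 'rV[R]_p * 'rV[R]_p * 'rV[R]_p :=
  match k with
  | 0 => (x0, z0, y0)
  | k'.+1 => ssadmm_step D k' (Bs k') (gams k')
               (ssadmm_state D x0 z0 y0 Bs gams k')
  end.

Definition ssadmm_output (D : 'I_n -> Dom) (x0 z0 y0 : 'rV[R]_p)
    (Bs : nat -> {set 'I_n}) (gams : nat -> 'rV[R]_p) (T : nat)
    : 'rV[R]_p :=
  (ssadmm_state D x0 z0 y0 Bs gams T).1.1.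

End ssADMM.

(* Output vectors are viewed in the measurable space p.-tuple R
   (product Borel sigma-algebra). *)
Definition rV_to_tuple {R : realType} {p : nat} (v : 'rV[R]_p) : p.-tuple R :=
  [tuple v ord0 i | i < p].

Definition neighboring {Dom : Type} {n : nat} (D D' : 'I_n -> Dom) : Prop :=
  exists i : 'I_n, forall j : 'I_n, j != i -> D j = D' j.

Section Renyi.
Context {R : realType} {d : measure_display} {T : measurableType d}.
Local Open Scope charge_scope.

Definition renyi_div (alpha : R) (P Q : probability T R) : \bar R :=
  if pselect (charge_of_finite_measure P `<< Q) is left _ then
    let I := (\int[Q]_x
       ((fine (('d (charge_of_finite_measure P) '/d Q) x)) `^ alpha)%:E)%E
    in if I is r%:E then (ln r / (alpha - 1))%:E else +oo%E
  else +oo%E.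

End Renyi.

(* Independence of a finite family of sigma-algebras (given as systems
   of events) on a probability space: product rule for every choice of
   one event per index (taking the whole space for unused indices gives
   the product rule for every sub-family).                             *)

Definition mutually_independent {R : realType} {d : measure_display}
    {Omega : measurableType d} (P : probability Omega R) {I : finType}
    (F : I -> set (set Omega)) : Prop :=
  forall E : I -> set Omega, (forall i, F i (E i)) ->
    P (\bigcap_(i in [set: I]) E i) = (\prod_(i : I) P (E i))%E.

(* Renyi differential privacy of a randomized mechanism given as a
   function M : dataset -> Omega -> output, on the probability space
   (Omega, P).  M D is the output random variable; its law is any
   probability measure mu on the output space with
   mu A = P (M D ^-1 A) for measurable A.                              *)

Definition rdp {R : realType} {d d' : measure_display}
    {Omega : measurableType d} (P : probability Omega R)
    {Out : measurableType d'} {Dom : Type} {n : nat}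
    (M : ('I_n -> Dom) -> Omega -> Out) (alpha eps : R) : Prop :=
  forall D D' : 'I_n -> Dom, neighboring D D' ->
  forall mu mu' : probability Out R,
    (forall A, measurable A -> mu A = P (M D @^-1` A)) ->
    (forall A, measurable A -> mu' A = P (M D' @^-1` A)) ->
    (renyi_div alpha mu mu' <= eps%:E)%E.

Definition eps_j {R : realType} (C sigma : R) (m j : nat) : R :=
  (j%:R * (2 * C / m%:R) ^+ 2) / (2 * sigma ^+ 2).

Definition eps_prime {R : realType} (C sigma : R) (n m alpha : nat) : R :=
  let q := m%:R / n%:R in
  (alpha%:R - 1)^-1 *
  ln (1 + q ^+ 2 * 'C(alpha, 2)%:R *
            Num.min (4 * (expR (eps_j C sigma m 2) - 1))
                    (2 * expR (eps_j C sigma m 2))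
        + \sum_(3 <= j < alpha.+1)
            q ^+ j * 'C(alpha, j)%:R * 2 * expR ((j%:R - 1) * eps_j C sigma m j)).

(* Main.v *)
(** The randomness of one iteration enters only through the noisy gradient: the
    next state is a fixed measurable function of the current state and of
    [g_k + gamma_k].  Relative to a centred Gaussian vector, the noisy gradient has,
    given the state, a density that is an average over batches of Gaussian tilts.
    Hence the laws of two runs on neighbouring datasets are images of measures with
    explicit densities, and the Renyi moment of order [alpha] of the image laws is
    at most the one upstairs (data processing, which here follows from the
    tangent-line inequality for [t ^ alpha]).  Induction on the iterations multiplies
    the moment by a one-step factor.

    For that factor, expand [P = Q + (P - Q)] by the binomial formula, so that only the
    integrals of [|P - Q|^j / Q^(j-1)], [j >= 2], matter.  Writing [P - Q] as [q] times an
    average over batches [J] containing the differing record, and [Q] as an average over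
    the same index set enlarged by a record [l] exchanged with it, joint
    convexity of [a^j / r^(j-1)] reduces everything to three Gaussian tilts whose
    means are pairwise at distance at most [2C/m]. *)

Require Import Defs.
From HB Require Import structures.
From mathcomp Require Import all_boot all_order all_algebra.
From mathcomp Require Import all_classical all_reals all_analysis.
From mathcomp Require Import perm measurable_realfun zify ring lra.
Import Order.TTheory GRing.Theory Num.Theory.
Import numFieldNormedType.Exports.
Local Open Scope classical_set_scope.
Local Open Scope ring_scope.

Set Implicit Arguments.
Unset Strict Implicit.
Unset Printing Implicit Defensive.

(** * Elementary inequalities for powers and their quotients *)

(** Convexity: the graph of [t ^+ a.+1] lies above its tangent at [y]. The induction multiplies the
    previous case by [t] and adds the nonnegative term [a.+1%:R * y ^+ a * (t - y) ^+ 2], which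
    keeps the argument purely algebraic. *)
Lemma tangent_pow_le (R : realFieldType) (a : nat) (t y : R) :
  0 <= t -> 0 <= y -> a.+1%:R * y ^+ a * t <= t ^+ a.+1 + a%:R * y ^+ a.+1.
Proof.
move=> t0 y0; elim: a => [|a IH]; first by rewrite expr0 mul0r addr0 expr1 !mul1r.
have := ler_wpM2l t0 IH.
have : 0 <= a.+1%:R * y ^+ a * (t - y) ^+ 2.
  by rewrite mulr_ge0 ?sqr_ge0// mulr_ge0// exprn_ge0.
rewrite !exprS -(natr1 a.+1) -(natr1 a); set u := y ^+ a; set v := t ^+ a.
by nra.
Qed.

(** Joint convexity of the perspective [a ^+ j.+1 / r ^+ j], in homogeneous form. *)
Lemma perspective_sum_le (R : realFieldType) (I : finType) (a r : I -> R) (j : nat) :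
  (forall i, 0 <= a i) -> (forall i, 0 < r i) -> (0 < #|I|)%N ->
  (\sum_i a i) ^+ j.+1 / (\sum_i r i) ^+ j <= \sum_i a i ^+ j.+1 / r i ^+ j.
Proof.
move=> a0 r0 /card_gt0P[i0 _]; set A := \sum_i a i; set Rr := \sum_i r i.
have Rr0 : 0 < Rr.
  by rewrite /Rr (bigD1 i0)//= ltr_pwDl// sumr_ge0// => i _; exact: ltW.
have A0 : 0 <= A by exact: sumr_ge0.
(* One tangent point, the ratio of the totals, serves every [i]: the tangent inequality at
   [a i / r i], weighted by [r i], then has linear terms that add up exactly, since [y * Rr = A]. *)
pose y := A / Rr; have y0 : 0 <= y by rewrite divr_ge0// ltW.
have pt i : j.+1%:R * y ^+ j * a i <= a i ^+ j.+1 / r i ^+ j + j%:R * y ^+ j.+1 * r i.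
  have ri0 : r i != 0 by rewrite gt_eqF.
  have := tangent_pow_le j (divr_ge0 (a0 i) (ltW (r0 i))) y0.
  move=> /(ler_wpM2r (ltW (r0 i))); rewrite mulrDl -(mulrA _ (a i / r i)) divfK//.
  suff -> : (a i / r i) ^+ j.+1 * r i = a i ^+ j.+1 / r i ^+ j by [].
  by rewrite expr_div_n (exprSr (r i)) invfM -!mulrA mulVf// mulr1.
have : \sum_i j.+1%:R * y ^+ j * a i <=
       \sum_i (a i ^+ j.+1 / r i ^+ j + j%:R * y ^+ j.+1 * r i).
  by apply: ler_sum => i _; exact: pt.
rewrite big_split/= -!mulr_sumr -/A -/Rr.
have yR : y ^+ j.+1 * Rr = y ^+ j * A by rewrite exprSr -mulrA divfK// gt_eqF.
have -> : A ^+ j.+1 / Rr ^+ j = y ^+ j * A by rewrite exprSr expr_div_n mulrAC.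
by rewrite -2!mulrA yR -(natr1 j) mulrDl mul1r; lra.
Qed.

(** Expand [(Q + (P - Q)) ^+ a]. The terms of degree 0 and 1 are kept exact, because they integrate
    to 1 and 0 when [P] and [Q] are probability densities. The term [a%:R * Q] stands on the left so
    that, for [P >= 0], only nonnegative functions have to be integrated. *)
Lemma ratio_pow_binomial_le (R : realFieldType) (a : nat) (P Q : R) :
  (0 < a)%N -> 0 < Q ->
  P ^+ a / Q ^+ a.-1 + a%:R * Q <= Q + a%:R * P +
    \sum_(2 <= j < a.+1) 'C(a, j)%:R * (`|P - Q| ^+ j / Q ^+ j.-1).
Proof.
move=> a0 Q0; have QN0 : Q != 0 by rewrite gt_eqF.
have E : P ^+ a / Q ^+ a.-1 =
    \sum_(0 <= j < a.+1) 'C(a, j)%:R * ((P - Q) ^+ j * Q ^+ (a - j) / Q ^+ a.-1).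
  rewrite -{1}(subrKC Q P) exprDn mulr_suml big_mkord; apply: eq_bigr => i _.
  by rewrite -(mulr_natl (_ * _)) -!mulrA (mulrCA (Q ^+ _)).
rewrite E big_ltn// big_ltn// bin0 bin1 subn0 subn1 expr0 expr1 !mul1r.
rewrite mulfK ?expf_neq0// -[X in Q ^+ X / _](prednK a0) exprS mulfK ?expf_neq0//.
rewrite mulrBr addrA -!addrA [leLHS](_ : _ = Q + (a%:R * P + \sum_(2 <= j < a.+1)
  'C(a, j)%:R * ((P - Q) ^+ j * Q ^+ (a - j) / Q ^+ a.-1))); last by ring.
rewrite !lerD2l; apply: ler_sum_nat => j /andP[j2 ja].
rewrite ler_wpM2l// -mulrA.
have -> : Q ^+ (a - j) / Q ^+ a.-1 = (Q ^+ j.-1)^-1.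
  have -> : a.-1 = (a - j + j.-1)%N by lia.
  by rewrite exprD invfM mulrA mulfV ?mul1r// expf_neq0.
rewrite ler_wpM2r ?invr_ge0 ?exprn_ge0 ?(ltW Q0)//.
by rewrite -normrX ler_norm.
Qed.

(** The difference of two nonnegative numbers is at most the larger one; this is the source of the
    factor 2 in the terms of the privacy bound. *)
Lemma normB_pow_le (R : realDomainType) (p q : R) (j : nat) :
  0 <= p -> 0 <= q -> `|p - q| ^+ j <= p ^+ j + q ^+ j.
Proof.
move=> p0 q0; have [pq|qp] := leP p q.
  rewrite distrC ger0_norm ?subr_ge0// ler_wpDl ?exprn_ge0//.
  by rewrite lerXn2r ?nnegrE ?subr_ge0// gerBl.
rewrite ger0_norm ?subr_ge0 ?(ltW qp)// ler_wpDr ?exprn_ge0//.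
by rewrite lerXn2r ?nnegrE ?subr_ge0 ?(ltW qp)// gerBl.
Qed.

(** * Borel sets of row vectors *)

Section measurable_rV.
Context {R : realType} {p : nat}.

(** Pulling the product Borel structure of tuples back along [rV_to_tuple] makes that map measurable
    by construction. *)
Let rV_measurable : set (set 'rV[R]_p) :=
  preimage_set_system setT rV_to_tuple measurable.

Let rV_set0 : rV_measurable set0.
Proof. by exists set0; rewrite ?preimage_set0 ?setI0. Qed.

Let rV_setC A : rV_measurable A -> rV_measurable (~` A).
Proof.
by move=> [B mB <-]; exists (~` B); [exact: measurableC|rewrite !setTI preimage_setC].
Qed.

Let rV_bigcup (F : (set 'rV[R]_p)^nat) :
  (forall i, rV_measurable (F i)) -> rV_measurable (\bigcup_i F i).
Proof.
move=> /(_ _)/cid2-/all_sig2[G mG GF]; exists (\bigcup_i G i).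
  by apply: bigcupT_measurable.
by rewrite setTI preimage_bigcup; apply: eq_bigcupr => i _; rewrite -GF setTI.
Qed.

HB.instance Definition _ := @isMeasurable.Build
  (measure_tuple_display (measure_tuple_display default_measure_display))
  'rV[R]_p rV_measurable rV_set0 rV_setC rV_bigcup.

End measurable_rV.

Section measurable_rV_fun.
Context {R : realType} {p : nat}.

Lemma measurable_rV_to_tuple :
  measurable_fun [set: 'rV[R]_p] (@rV_to_tuple R p).
Proof. by move=> _ A mA; exists A. Qed.

Lemma measurable_fun_rVP d (T : measurableType d) (f : T -> 'rV[R]_p) :
  measurable_fun setT f <-> forall i, measurable_fun setT (fun x => f x ord0 i).
Proof.
split=> [mf i|mf].
  rewrite [X in measurable_fun _ X](_ : _ = (@tnth _ _ ^~ i) \o (rV_to_tuple \o f)).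
    apply: measurableT_comp; first exact: measurable_tnth.
    exact: measurableT_comp measurable_rV_to_tuple mf.
  by apply/funext => x /=; rewrite tnth_mktuple.
move=> _ _ [A mA <-]; rewrite !setTI -comp_preimage -[X in measurable X]setTI.
suff : measurable_fun setT (rV_to_tuple \o f) by apply.
apply/measurable_fun_tnthP => i; apply: eq_measurable_fun (mf i) => x _ /=.
by rewrite tnth_mktuple.
Qed.

Lemma measurable_rV_coord (i : 'I_p) :
  measurable_fun [set: 'rV[R]_p] (fun v : 'rV[R]_p => v ord0 i).
Proof. by move: i; apply/measurable_fun_rVP; exact: measurable_id. Qed.

Lemma measurable_rV_box (E : 'I_p -> set R) : (forall i, measurable (E i)) ->
  measurable [set v : 'rV[R]_p | forall i, E i (v ord0 i)].
Proof.
move=> mE.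
rewrite (_ : [set _ | _] =
  \big[setI/setT]_(i < p) ((fun v : 'rV[R]_p => v ord0 i) @^-1` E i)).
  apply: bigsetI_measurable => i _; rewrite -[X in measurable X]setTI.
  exact: measurable_rV_coord.
rewrite -bigcap_seq; apply/seteqP; split=> [v vE i _|v vE i]; first exact: vE.
by apply: (vE i); rewrite /= mem_index_enum.
Qed.

(** Balls of row vectors are boxes, and the boxes with rational centre and radius [k.+1%:R^-1] are
    countably many; an open set is the union of those that it contains. *)
Lemma open_measurable_rV (U : set 'rV[R]_p) : open U -> measurable U.
Proof.
move=> oU.
pose c (q : 'rV[rat]_p) : 'rV[R]_p := map_mx ratr q.
pose bx (q : 'rV[rat]_p * nat) :=
  [set v : 'rV[R]_p | forall i, `|c q.1 ord0 i - v ord0 i| < q.2.+1%:R^-1].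
rewrite (_ : U = \bigcup_(q in [set q | bx q `<=` U]) bx q).
  rewrite bigcup_mkcond; apply: countable_bigcupT_measurable => [|q].
    exact: countableP.
  case: ifPn => // _; apply: (measurable_rV_box
    (E := fun i => [set x | `|c q.1 ord0 i - x| < q.2.+1%:R^-1])) => i.
  rewrite (_ : [set _ | _] =
    `]c q.1 ord0 i - q.2.+1%:R^-1, c q.1 ord0 i + q.2.+1%:R^-1[%classic).
    exact: measurable_itv.
  by apply/funext => x; rewrite /= in_itv/= ltr_distlC.
apply/seteqP; split=> [v Uv|v [q qU] qv]; last exact: qU.
have /nbhs_ballP[e /= e0 eU] := open_nbhs_nbhs (conj oU Uv).
have [k ke] : exists k : nat, k.+1%:R^-1 < e / 2.
  have := near_infty_natSinv_lt (PosNum (divr_gt0 e0 (ltr0n _ 2))).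
  by move=> [k _ kP]; exists k; exact: (kP k (leqnn k)).
have k0 : (0 : R) < k.+1%:R^-1 by rewrite invr_gt0.
(* A rational centre within [k.+1%:R^-1 < e / 2] of [v] in each coordinate gives a box that contains
   [v] and, by the triangle inequality, stays in the ball of radius [e]. *)
have hq i : {q : rat | `|ratr q - v ord0 i| < k.+1%:R^-1}.
  apply: cid; have : v ord0 i - k.+1%:R^-1 < v ord0 i + k.+1%:R^-1.
    by rewrite ltrBlDr -addrA ltrDl addr_gt0.
  move=> /rat_in_itvoo[q]; rewrite in_itv/= => qv; exists q.
  by rewrite ltr_distl.
exists (\row_i sval (hq i), k); last first.
  by move=> i /=; rewrite /c !mxE; exact: svalP (hq i).
move=> w bw; apply: eU; split=> // i j; rewrite !ord1 /ball/=.
have := bw j; rewrite /c !mxE/= => h1; have h2 := svalP (hq j).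
apply: le_lt_trans (ler_distD (ratr (sval (hq j))) _ _) _.
rewrite (splitr e) (distrC (v _ _)) ltrD//; [exact: lt_trans h2 ke|exact: lt_trans h1 ke].
Qed.

Lemma measurable_fun_continuous_rV (g : 'rV[R]_p -> R) :
  continuous g -> measurable_fun setT g.
Proof.
move=> cg; apply: (measurability (@RGenOInfty.G R)); first exact: RGenOInfty.measurableE.
move=> _ [_ [a ->] <-]; rewrite setTI; apply: open_measurable_rV.
by apply: open_comp => [x _|]; [exact: cg|exact: interval_open].
Qed.

(** Boxes are stable under intersection and generate the product sigma-algebra, so finite measures
    agreeing on them are equal. Independence of scalar coordinates only speaks about such boxes. *)
Lemma measure_prod_rV_eq d (S : measurableType d)
    (mu nu : {measure set (S * 'rV[R]_p) -> \bar R}) :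
  (mu setT < +oo)%E ->
  (forall A (E : 'I_p -> set R), measurable A -> (forall i, measurable (E i)) ->
    mu (A `*` [set v : 'rV[R]_p | forall i, E i (v ord0 i)]) =
    nu (A `*` [set v : 'rV[R]_p | forall i, E i (v ord0 i)])) ->
  forall Z, measurable Z -> mu Z = nu Z.
Proof.
move=> mufin munu.
pose G : set (set (S * 'rV[R]_p)) := [set Z | exists A (E : 'I_p -> set R),
  [/\ measurable A, (forall i, measurable (E i)) &
    Z = A `*` [set v : 'rV[R]_p | forall i, E i (v ord0 i)]]].
have GT : G setT.
  exists setT, (fun=> setT); split => //.
  by apply/seteqP; split => // -[x v] _; split.
have mG : measurable = <<s G >>.
  apply/seteqP; split; last first.
    apply: smallest_sub; first exact: sigma_algebra_measurable.
    by move=> _ [A [E [mA mE ->]]]; apply: measurableX => //; exact: measurable_rV_box.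
  move=> Z mZ.
  pose X := g_sigma_algebraType G.
  have mXG A : G A -> measurable (A : set X) by exact: sub_gen_smallest.
  (* Generation is proved by showing that the identity out of the space carrying [<<s G >>] is
     measurable, which can be checked coordinate by coordinate. *)
  suff : measurable_fun [set: X] (id : X -> S * 'rV[R]_p).
    by move=> /(_ measurableT _ mZ); rewrite setTI.
  apply/(measurable_fun_pairP (T := X)); split.
    move=> _ A mA; rewrite setTI; apply: mXG; exists A, (fun=> setT).
    by split=> //; apply/seteqP; split => [[x v]//=|[x v] []].
  apply/measurable_fun_rVP => i _ B mB; rewrite setTI; apply: mXG.
  exists setT, (fun j => if j == i then B else setT); split => //.
    by move=> j; case: ifP.
  apply/seteqP; split => [[x v] /= vB|[x v] [_ /= /(_ i)]]; last by rewrite eqxx.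
  by split => // j /=; case: eqP => [->|].
apply: (measure_unique G (fun=> setT)) => //.
- move=> _ _ [A [E [mA mE ->]]] [A' [E' [mA' mE' ->]]].
  exists (A `&` A'), (fun i => E i `&` E' i); split.
  + exact: measurableI.
  + by move=> i; exact: measurableI.
  + rewrite -setXI; congr (_ `*` _).
    by apply/seteqP; split => [v [h1 h2] i|v h]; [split|split => i; case: (h i)].
- by apply/seteqP; split => // x _; exists 0%N.
- by move=> _ [A [E [mA mE ->]]]; exact: munu.
Qed.

End measurable_rV_fun.

(** * Densities and Gaussian vectors *)

Definition law d d' (T : measurableType d) (T' : measurableType d')
    (R : realType) (P : probability T R) (f : T -> T')
    (mf : measurable_fun setT f) : probability T' R :=
  let mix := isMeasurableFun.Build _ _ _ _ f mf in
  let X : {mfun T >-> T'} := HB.pack f mix in distribution P X.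

Lemma lawE d d' (T : measurableType d) (T' : measurableType d')
    (R : realType) (P : probability T R) (f : T -> T')
    (mf : measurable_fun setT f) A : law P mf A = P (f @^-1` A).
Proof. by []. Qed.

Lemma ge0_integral_law d d' (T : measurableType d) (T' : measurableType d')
    (R : realType) (P : probability T R) (f : T -> T')
    (mf : measurable_fun setT f) (F : T' -> \bar R) :
  measurable_fun setT F -> (forall y, 0 <= F y)%E ->
  (\int[law P mf]_y F y = \int[P]_x F (f x))%E.
Proof.
move=> mF F0; pose mix := isMeasurableFun.Build _ _ _ _ f mf.
pose f' : {mfun T >-> T'} := HB.pack f mix.
exact: (@ge0_integral_pushforward _ _ _ _ _ f' (measurable_funPT f') P setT F).
Qed.

Section density.
Import HBNNSimple.
Local Open Scope ereal_scope.
Context d d' (X : measurableType d) (Y : measurableType d') (R : realType).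
Variables (lam : {measure set X -> \bar R}) (mu : {measure set Y -> \bar R}).
Variables (g : X -> Y) (a : X -> R).
Hypotheses (mg : measurable_fun setT g) (ma : measurable_fun setT a).
Hypothesis a0 : forall x, (0 <= a x)%R.
Hypothesis mu_density : forall A, measurable A ->
  mu A = \int[lam]_(x in g @^-1` A) (a x)%:E.

Let nnsfun_integral_density (f : {nnsfun Y >-> R}) :
  \int[mu]_y (f y)%:E = \int[lam]_x ((f (g x))%:E * (a x)%:E).
Proof.
rewrite integralT_nnsfun sintegralE.
under [RHS]eq_integral.
  move=> x _; rewrite fimfunE -fsumEFin// ge0_mule_fsuml; last first.
    by move=> r; exact: nnfun_muleindic_ge0.
  over.
rewrite ge0_integral_fsum//; last 2 first.
- move=> r; apply: emeasurable_funM; last exact/measurable_EFinP.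
  apply/measurable_EFinP; apply: measurable_funM => //.
  exact: measurableT_comp.
- by move=> r x _; rewrite mule_ge0 ?lee_fin ?a0//; exact: nnfun_muleindic_ge0.
apply: eq_fsbigr => r; rewrite inE => -[y _ <-].
rewrite mu_density; last exact: measurable_sfunP.
have mfg : measurable (g @^-1` (f @^-1` [set f y])).
  by rewrite -[X in measurable X]setTI; apply: mg => //; exact: measurable_sfunP.
rewrite integral_mkcond -ge0_integralZl//; last 3 first.
- by apply/(measurable_restrictT _ mfg)/measurable_funTS/measurable_EFinP.
- by move=> x _; rewrite erestrict_ge0// => z _; rewrite lee_fin.
- by rewrite lee_fin.
apply: eq_integral => x _; rewrite EFinM -muleA patchE indicE/=.
have -> : (x \in g @^-1` (f @^-1` [set f y])) = (g x \in f @^-1` [set f y]).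
  by apply/idP/idP; rewrite !inE.
by case: ifP => _; rewrite ?mul1e// mul0e.
Qed.

(** Simple functions reduce to [mu_density] on their level sets, and monotone convergence does the
    rest. With [g := id] this is integration against a density on the space itself. *)
Lemma ge0_integral_density (F : Y -> \bar R) :
  measurable_fun setT F -> (forall y, 0 <= F y) ->
  \int[mu]_y F y = \int[lam]_x (F (g x) * (a x)%:E).
Proof.
move=> mF F0; pose f_ := nnsfun_approx measurableT mF.
have cf y : (EFin \o f_^~ y) @ \oo --> F y.
  by apply: cvg_nnsfun_approx => // z _; exact: F0.
transitivity (limn (fun n => \int[mu]_y (f_ n y)%:E)).
  rewrite -monotone_convergence//.
  - by apply: eq_integral => y _; apply/esym/cvg_lim => //; exact: cf.
  - by move=> n; exact/measurable_EFinP/measurable_funP.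
  - by move=> n y _; rewrite lee_fin.
  - by move=> y _ m n mn; rewrite lee_fin; exact/lefP/nd_nnsfun_approx.
transitivity (limn (fun n => \int[lam]_x ((f_ n (g x))%:E * (a x)%:E))).
  by congr (limn _); apply/funext => n; exact: nnsfun_integral_density.
rewrite -monotone_convergence//.
- apply: eq_integral => x _; apply/cvg_lim => //.
  by apply: cvgeZr => //; exact: cf.
- move=> n; apply/measurable_EFinP/measurable_funM => //.
  exact: measurableT_comp.
- by move=> n x _; rewrite lee_fin mulr_ge0.
- move=> x _ m n mn; rewrite lee_fin ler_wpM2r//.
  exact/lefP/nd_nnsfun_approx.
Qed.

End density.

(** * Centred Gaussian vectors and their translates *)

Section gaussian.
Context {R : realType}.

Definition rV_cons {p} (x : R * 'rV[R]_p) : 'rV[R]_p.+1 :=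
  \row_i (if unlift ord0 i is Some j then x.2 ord0 j else x.1).

Lemma rV_cons_ord0 p (x : R * 'rV[R]_p) : rV_cons x ord0 ord0 = x.1.
Proof. by rewrite mxE unlift_none. Qed.

Lemma rV_cons_lift p (x : R * 'rV[R]_p) j :
  rV_cons x ord0 (lift ord0 j) = x.2 ord0 j.
Proof. by rewrite mxE liftK. Qed.

Lemma measurable_rV_cons p : measurable_fun setT (@rV_cons p).
Proof.
apply/measurable_fun_rVP => i; case: (unliftP ord0 i) => [j ->|->].
  rewrite (_ : (fun _ => _) = (fun v : 'rV[R]_p => v ord0 j) \o snd).
    by apply: measurableT_comp => //; exact: measurable_rV_coord.
  by apply/funext => x; rewrite rV_cons_lift.
rewrite (_ : (fun _ => _) = fst)//.
by apply/funext => x; rewrite rV_cons_ord0.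
Qed.

(** Independent coordinates of variance [s ^+ 2] are adjoined one at a time, so that statements
    about the vector follow by induction from binary products and Tonelli's theorem. *)
Fixpoint gauss_rV (s : R) (p : nat) : probability 'rV[R]_p R :=
  match p with
  | 0 => dirac (0 : 'rV[R]_0)
  | p'.+1 => law (normal_prob 0 s \x gauss_rV s p')%E (@measurable_rV_cons p')
  end.

Lemma gauss_rVS (s : R) p : gauss_rV s p.+1 =
  law (normal_prob 0 s \x gauss_rV s p)%E (@measurable_rV_cons p).
Proof. by []. Qed.

Lemma gauss_rV_box (s : R) p (E : 'I_p -> set R) : (forall i, measurable (E i)) ->
  gauss_rV s p [set v | forall i, E i (v ord0 i)] =
  (\prod_(i < p) normal_prob 0 s (E i))%E.
Proof.
elim: p E => [|p IH] E mE /=.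
  by rewrite big_ord0 diracE mem_set// => -[].
rewrite big_ord_recl; pose E' (i : 'I_p) : set R := E (lift ord0 i).
have mE' i : measurable (E' i) by exact: mE.
rewrite (_ : _ @^-1` _ = E ord0 `*` [set v : 'rV[R]_p | forall i, E' i (v ord0 i)]).
  rewrite product_measure1E; [|exact: mE|exact: measurable_rV_box].
  by congr (_ * _)%E; exact: IH.
apply/seteqP; split => [x /= xE|x [/= x1 x2] i].
  split => [|i]; first by have := xE ord0; rewrite rV_cons_ord0.
  by have := xE (lift ord0 i); rewrite rV_cons_lift.
by case: (unliftP ord0 i) => [j ->|->]; [rewrite rV_cons_lift; exact: x2|rewrite rV_cons_ord0].
Qed.

Local Open Scope ereal_scope.

Lemma lebesgue_measure_addl (v : R) (A : set R) : measurable A ->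
  pushforward lebesgue_measure
    (fun g : measurableTypeR R => (v + g)%R : measurableTypeR R) A =
  lebesgue_measure A.
Proof.
move=> mA; pose f (g : measurableTypeR R) : measurableTypeR R := (v + g)%R.
have mf : measurable_fun setT f by exact: measurable_funD.
pose mix := isMeasurableFun.Build _ _ _ _ f mf.
pose f' : {mfun measurableTypeR R >-> measurableTypeR R} := HB.pack f mix.
apply/esym/(@lebesgue_measure_unique R (pushforward lebesgue_measure f')) => //= _ [[a b]] _ <-.
rewrite /pushforward (_ : _ @^-1` _ = `](a - v)%R, (b - v)%R]%classic).
  by rewrite !lebesgue_measure_itv/= !lte_fin ltrD2r -!EFinD opprD addrACA subrr addr0.
by apply/funext => x; rewrite /= !in_itv/= ltrBlDl lerBrDl.
Qed.

(** The exponential is the quotient of the normal densities at [g - v] and at [g]; the substitution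
    itself is translation invariance of Lebesgue measure. *)
Lemma ge0_integral_normal_addl (s v : R) (F : R -> \bar R) : s != 0%R ->
  measurable_fun setT F -> (forall x, 0 <= F x) ->
  \int[normal_prob 0 s]_g F (v + g)%R =
  \int[normal_prob 0 s]_g (F g * (expR ((2 * v * g - v ^+ 2) / (2 * s ^+ 2)))%:E).
Proof.
move=> s0 mF F0.
have mpdf := @measurable_normal_pdf R 0 s.
have key (H : R -> \bar R) : measurable_fun setT H -> (forall x, 0 <= H x) ->
    \int[normal_prob 0 s]_g H g = \int[lebesgue_measure]_g (H g * (normal_pdf 0 s g)%:E).
  move=> mH H0.
  apply: (@ge0_integral_density _ _ (measurableTypeR R) (measurableTypeR R) R
    lebesgue_measure (normal_prob 0 s) id (normal_pdf 0 s)) => //.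
  by move=> x; exact: normal_pdf_ge0.
have madd : measurable_fun setT (fun g : R => v + g)%R by exact: measurable_funD.
have msub : measurable_fun setT (fun g : R => g - v)%R by exact: measurable_funB.
rewrite key//; last exact: measurableT_comp.
rewrite key; last 2 first.
- apply: emeasurable_funM => //; apply/measurable_EFinP.
  apply: measurableT_comp => //; apply: measurable_funM => //.
  by apply: measurable_funB => //; exact: measurable_funM.
- by move=> x; rewrite mule_ge0// lee_fin expR_ge0.
pose H g := F g * (normal_pdf 0 s (g - v))%:E.
have mH : measurable_fun setT H.
  by apply: emeasurable_funM => //; apply/measurable_EFinP; exact: measurableT_comp.
have H0 x : 0 <= H x by rewrite mule_ge0// lee_fin normal_pdf_ge0.
transitivity (\int[lebesgue_measure]_g H g); last first.
  apply: eq_integral => g _; rewrite /H -muleA -EFinM; congr (_ * _%:E).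
  rewrite normal_pdfE// /normal_fun mulrCA -expRD; congr (_ * expR _)%R.
  by rewrite -mulr_natl; field.
transitivity (\int[lebesgue_measure]_g (H \o (fun g => v + g)%R) g).
  by apply: eq_integral => g _; rewrite /H/= addrAC subrr add0r.
rewrite -(@ge0_integral_pushforward _ _ (measurableTypeR R) (measurableTypeR R) R
  (fun g => v + g)%R madd lebesgue_measure setT H)//.
by apply: eq_measure_integral => A mA _; exact: lebesgue_measure_addl.
Qed.

End gaussian.

(* The density of [v + G] relative to [G], for [G] centred Gaussian with covariance [s ^+ 2]. *)
Definition gauss_tilt {R : realType} (s : R) {p} (v g : 'rV[R]_p) : R :=
  expR (\sum_(i < p) (2 * v ord0 i * g ord0 i - v ord0 i ^+ 2) / (2 * s ^+ 2)).

Lemma measurable_gauss_tilt d (T : measurableType d) (R : realType) (s : R) p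
    (v g : T -> 'rV[R]_p) :
  measurable_fun setT v -> measurable_fun setT g ->
  measurable_fun setT (fun x => gauss_tilt s (v x) (g x)).
Proof.
move=> /measurable_fun_rVP mv /measurable_fun_rVP mg.
apply: measurableT_comp => //; apply: measurable_sum => i.
apply: measurable_funM => //; apply: measurable_funB.
  by apply: measurable_funM => //; exact: measurable_funM.
exact: measurable_funX.
Qed.

Section gaussian_translation.
Context {R : realType}.
Local Open Scope ereal_scope.

(** The Cameron-Martin formula in finite dimension. The tail of the vector is translated by the
    induction hypothesis and the first coordinate by the scalar case; the two exponential factors
    multiply to the tilt by [v]. *)
Lemma ge0_integral_gauss_translate (s : R) p (v : 'rV[R]_p) (F : 'rV[R]_p -> \bar R) :
  s != 0%R -> measurable_fun setT F -> (forall x, 0 <= F x) ->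
  \int[gauss_rV s p]_g F (v + g)%R =
  \int[gauss_rV s p]_g (F g * (gauss_tilt s v g)%:E).
Proof.
move=> s0; elim: p v F => [|p IH] v F mF F0.
  apply: eq_integral => g _; rewrite /gauss_tilt big_ord0 expR0 mule1.
  by congr F; apply/rowP => -[].
have mcons := @measurable_rV_cons R p.
have E H : measurable_fun setT H -> (forall x, 0 <= H x) ->
    \int[gauss_rV s p.+1]_g H g =
    \int[normal_prob 0 s]_x \int[gauss_rV s p]_y H (rV_cons (x, y)).
  move=> mH H0; rewrite gauss_rVS ge0_integral_law//.
  have mHc : measurable_fun setT (H \o @rV_cons R p) by exact: measurableT_comp.
  exact: (fubini_tonelli1 (m1 := normal_prob 0 s) (m2 := gauss_rV s p) _ mHc (fun z => H0 _)).
pose v' : 'rV[R]_p := (\row_j v ord0 (lift ord0 j))%R.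
have mFD : measurable_fun setT (fun g : 'rV[R]_p.+1 => F (v + g)%R).
  apply: measurableT_comp => //; apply/measurable_fun_rVP => i.
  rewrite (_ : (fun _ => _) = (fun g : 'rV[R]_p.+1 => v ord0 i + g ord0 i)%R).
    by apply: measurable_funD => //; exact: measurable_rV_coord.
  by apply/funext => g; rewrite mxE.
have mtilt q (w : 'rV[R]_q) : measurable_fun setT (gauss_tilt s w).
  exact: (measurable_gauss_tilt s (v := cst w) (g := id)).
have FT0 g : 0 <= F g * (gauss_tilt s v g)%:E by rewrite mule_ge0// lee_fin expR_ge0.
rewrite E// E//; last by apply: emeasurable_funM => //; exact/measurable_EFinP/mtilt.
have consD x y : (v + rV_cons (x, y) = rV_cons (v ord0 ord0 + x, v' + y))%R.
  apply/rowP => i; rewrite mxE; case: (unliftP ord0 i) => [j ->|->].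
    by rewrite !rV_cons_lift/= !mxE.
  by rewrite !rV_cons_ord0.
have mFc x : measurable_fun setT (fun y => F (rV_cons (x, y))).
  apply: measurableT_comp => //; apply: (measurableT_comp mcons).
  exact: measurable_pair1.
pose K (z : R * 'rV[R]_p) := F (rV_cons z) * (gauss_tilt s v' z.2)%:E.
have K0 z : 0 <= K z by rewrite mule_ge0// lee_fin expR_ge0.
have mK : measurable_fun setT K.
  apply: emeasurable_funM; first exact: measurableT_comp.
  by apply/measurable_EFinP; exact: (measurableT_comp (mtilt _ v') measurable_snd).
pose H x := \int[gauss_rV s p]_y K (x, y).
transitivity (\int[normal_prob 0 s]_x H (v ord0 ord0 + x)%R).
  apply: eq_integral => x _.
  under eq_integral do rewrite consD.
  exact: (IH v' (fun y => F (rV_cons ((v ord0 ord0 + x)%R, y))) (mFc _) (fun=> F0 _)).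
rewrite ge0_integral_normal_addl//; last 2 first.
- exact: (measurable_fun_fubini_tonelli_F (m2 := gauss_rV s p) K mK K0).
- by move=> x; exact: integral_ge0.
apply: eq_integral => x _; rewrite -ge0_integralZr//; last first.
  exact: measurableT_comp mK (measurable_pair1 _).
apply: eq_integral => y _; rewrite /K -muleA -EFinM; congr (_ * _%:E).
rewrite /gauss_tilt -expRD big_ord_recl rV_cons_ord0 addrC; congr (expR (_ + _))%R.
by apply: eq_bigr => j _; rewrite !mxE liftK.
Qed.

End gaussian_translation.


(** * Data processing *)

Lemma measurable_funV_gt0 d (T : measurableType d) (R : realType) (b : T -> R) :
  measurable_fun setT b -> (forall x, 0 < b x) ->
  measurable_fun setT (fun x => (b x)^-1).
Proof.
move=> mb b0; rewrite (_ : (fun _ => _) = fun x => expR (- ln (b x))).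
  apply: measurableT_comp => //; apply: measurableT_comp => //.
  exact: measurableT_comp (@measurable_ln R) mb.
by apply/funext => x; rewrite expRN lnK// posrE.
Qed.

Section data_processing.
Local Open Scope ereal_scope.
Context d d' (X : measurableType d) (Y : measurableType d') (R : realType).
Variables (lam : {measure set X -> \bar R}) (mu nu : probability Y R).
Variables (g : X -> Y) (a b : X -> R) (L : Y -> R).
Hypotheses (mg : measurable_fun setT g) (ma : measurable_fun setT a).
Hypotheses (mb : measurable_fun setT b) (mL : measurable_fun setT L).
Hypotheses (a0 : forall x, (0 <= a x)%R) (b0 : forall x, (0 < b x)%R).
Hypothesis (L0 : forall y, (0 <= L y)%R).
Hypothesis mu_a : forall A, measurable A ->
  mu A = \int[lam]_(x in g @^-1` A) (a x)%:E.
Hypothesis nu_b : forall A, measurable A ->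
  nu A = \int[lam]_(x in g @^-1` A) (b x)%:E.
Hypothesis mu_L : forall A, measurable A -> mu A = \int[nu]_(y in A) (L y)%:E.

(* Tangent-line inequality for [t ^+ k.+1], taken at the truncated density of
   the image measures and evaluated at the density ratio upstairs. *)
Let trunc_le (k c : nat) :
  \int[nu]_y (Num.min (L y) c%:R ^+ k.+1)%:E <=
  \int[lam]_x (a x ^+ k.+1 / b x ^+ k)%:E.
Proof.
pose y_ (y : Y) : R := Num.min (L y) c%:R.
have y0 y : (0 <= y_ y)%R by rewrite le_min L0 ler0n.
have my : measurable_fun setT y_ by exact: measurable_minr.
have myX j : measurable_fun setT (fun y => (y_ y ^+ j)%:E).
  by apply/measurable_EFinP; exact: measurable_funX.
have myg j : measurable_fun setT (fun x => y_ (g x) ^+ j)%R.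
  by apply: measurable_funX; exact: measurableT_comp.
have mratio : measurable_fun setT (fun x => a x ^+ k.+1 / b x ^+ k)%R.
  apply: measurable_funM; first exact: measurable_funX.
  by apply: measurable_funV_gt0 => [|x]; [exact: measurable_funX|rewrite exprn_gt0].
pose I := \int[nu]_y (y_ y ^+ k.+1)%:E; set M := \int[lam]_x _.
change (I <= M).
have M0 : 0 <= M.
  by apply: integral_ge0 => x _; rewrite lee_fin divr_ge0 ?exprn_ge0// ltW.
have I0 : 0 <= I by apply: integral_ge0 => y _; rewrite lee_fin exprn_ge0.
(* Truncation at [c] is what makes [I] finite; the end of the proof subtracts [k%:R%:E * I] from
   both sides. *)
have Ifin : I \is a fin_num.
  rewrite ge0_fin_numE//.
  apply: (@le_lt_trans _ _ (\int[nu]_y (c%:R ^+ k.+1)%:E)); last first.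
    rewrite (integral_cst nu measurableT) -/(cst _) [X in _ * X](_ : _ = 1) ?mule1 ?ltry//.
    exact: probability_setT.
  apply: ge0_le_integral => //.
  - by move=> y _; rewrite lee_fin exprn_ge0.
  - by move=> y _; rewrite lee_fin lerXn2r ?nnegrE// ge_min lexx orbT.
have dnu F : measurable_fun setT F -> (forall y, 0 <= F y) ->
    \int[nu]_y F y = \int[lam]_x (F (g x) * (b x)%:E).
  by apply: ge0_integral_density => // x; exact: ltW.
have dmu F : measurable_fun setT F -> (forall y, 0 <= F y) ->
    \int[mu]_y F y = \int[lam]_x (F (g x) * (a x)%:E).
  exact: ge0_integral_density.
have dL F : measurable_fun setT F -> (forall y, 0 <= F y) ->
    \int[mu]_y F y = \int[nu]_y (F y * (L y)%:E).
  exact: (ge0_integral_density (g := id)).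
(* [L] is the density of [mu], so one factor [y_ <= L] turns the integral against [nu] into one
   against [mu]. *)
have h1 : I <= \int[mu]_y (y_ y ^+ k)%:E.
  rewrite dL//; last by move=> y; rewrite lee_fin exprn_ge0.
  apply: ge0_le_integral => //.
  - by move=> y _; rewrite lee_fin exprn_ge0.
  - by apply: emeasurable_funM => //; exact/measurable_EFinP.
  - move=> y _; rewrite -EFinM lee_fin exprSr ler_wpM2l ?exprn_ge0//.
    by rewrite ge_min lexx.
have h2 : k.+1%:R%:E * \int[mu]_y (y_ y ^+ k)%:E <= M + k%:R%:E * I.
  rewrite dmu//; last by move=> y; rewrite lee_fin exprn_ge0.
  rewrite /I dnu//; last by move=> y; rewrite lee_fin exprn_ge0.
  have side (u v : X -> R) : measurable_fun setT u -> measurable_fun setT v ->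
      measurable_fun setT (fun x => (u x)%:E * (v x)%:E).
    by move=> mu' mv'; apply: emeasurable_funM; exact/measurable_EFinP.
  rewrite -[X in X <= _]ge0_integralZl//; do ?[exact: side|
    by move=> x _; rewrite lee_fin mulr_ge0 ?exprn_ge0].
  rewrite -[X in _ + X]ge0_integralZl//; do ?[exact: side|
    by move=> x _; rewrite lee_fin mulr_ge0 ?exprn_ge0// ltW].
  rewrite -ge0_integralD//; last 4 first.
  - by move=> x _; rewrite lee_fin divr_ge0 ?exprn_ge0// ltW.
  - exact/measurable_EFinP.
  - by move=> x _; rewrite lee_fin !mulr_ge0 ?exprn_ge0// ltW.
  - by apply/measurable_EFinP; do 2 apply: measurable_funM => //.
  apply: ge0_le_integral => //.
  - by move=> x _; rewrite lee_fin !mulr_ge0 ?exprn_ge0.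
  - by apply/measurable_EFinP; do 2 apply: measurable_funM => //.
  - by apply/measurable_EFinP; apply: measurable_funD => //; do 2 apply: measurable_funM => //.
  move=> x _; rewrite -!EFinM -EFinD lee_fin -/(y_ (g x)).
  have bN0 : b x != 0%R by rewrite gt_eqF.
  have := tangent_pow_le k (divr_ge0 (a0 x) (ltW (b0 x))) (y0 (g x)).
  move=> /(ler_wpM2r (ltW (b0 x))); rewrite mulrDl -(mulrA _ (a x / b x)%R) divfK//.
  suff -> : ((a x / b x) ^+ k.+1 * b x = a x ^+ k.+1 / b x ^+ k)%R.
    by rewrite !mulrA.
  by rewrite expr_div_n (exprSr (b x)) invfM -!mulrA mulVf// mulr1.
move: I Ifin I0 h1 h2 => /= I Ifin I0 h1 h2.
have : k.+1%:R%:E * I <= M + k%:R%:E * I.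
  by apply: le_trans h2; rewrite lee_wpmul2l// lee_fin.
case: I Ifin {I0 h1 h2} => [i| |]// _; case: M M0 => [r| |]//= _; rewrite ?leey//.
by rewrite -!EFinM -EFinD !lee_fin -natr1 mulrDl mul1r; lra.
Qed.

(** Let the truncation level tend to infinity: at each point the truncated powers increase and are
    eventually constant, so monotone convergence applies. *)
Lemma density_moment_le (k : nat) :
  \int[nu]_y (L y ^+ k.+1)%:E <= \int[lam]_x (a x ^+ k.+1 / b x ^+ k)%:E.
Proof.
pose h (c : nat) (y : Y) := (Num.min (L y) c%:R ^+ k.+1)%:E.
have hmono y : nondecreasing_seq (h^~ y).
  move=> i j ij; rewrite lee_fin lerXn2r ?nnegrE ?le_min ?L0 ?ler0n//.
  rewrite ge_min lexx/= ge_min; apply/orP; right.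
  by rewrite ler_nat.
have hcvg y : limn (h^~ y) = (L y ^+ k.+1)%:E.
  apply: cvg_lim => //; apply: cvg_near_cst.
  exists (Num.trunc (L y)).+1 => // c /= cL.
  rewrite /h min_l//; apply: ltW.
  by rewrite (lt_le_trans (truncnS_gt _))// ler_nat.
rewrite (_ : integral _ _ _ = \int[nu]_y limn (h^~ y)); last first.
  by apply: eq_integral => y _; rewrite hcvg.
have mh c : measurable_fun setT (h c).
  by apply/measurable_EFinP; apply: measurable_funX; exact: measurable_minr.
have h0 c y : 0 <= h c y.
  by rewrite lee_fin exprn_ge0// le_min L0 ler0n.
rewrite monotone_convergence//; apply: lime_le.
  apply: ereal_nondecreasing_is_cvgn => i j ij.
  by apply: ge0_le_integral => // y _; exact: hmono.
by apply: nearW => c; exact: trunc_le.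
Qed.

End data_processing.

(** * Moments of Gaussian mixtures *)

(** Bundles the two side conditions needed to treat integrals of real functions as additive without
    integrability. *)
Definition nnmeasurable d (T : measurableType d) (R : realType) (f : T -> R) :=
  measurable_fun setT f /\ forall x, 0 <= f x.

Section nnmeasurable_integral.
Context d (T : measurableType d) (R : realType) (mu : {measure set T -> \bar R}).
Implicit Types f g : T -> R.
Local Open Scope ereal_scope.

Lemma nnmeasurableD f g : nnmeasurable f -> nnmeasurable g ->
  nnmeasurable (fun x => f x + g x)%R.
Proof.
by move=> [mf f0] [mg g0]; split => [|x]; [exact: measurable_funD|rewrite addr_ge0].
Qed.

Lemma nnmeasurableZ (c : R) f : (0 <= c)%R -> nnmeasurable f ->
  nnmeasurable (fun x => c * f x)%R.
Proof.
by move=> c0 [mf f0]; split => [|x]; [exact: measurable_funM|rewrite mulr_ge0].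
Qed.

Lemma nnmeasurable_sum (I : Type) (r : seq I) (F : I -> T -> R) :
  (forall i, nnmeasurable (F i)) -> nnmeasurable (fun x => \sum_(i <- r) F i x)%R.
Proof.
move=> F0; split => [|x]; first by apply: measurable_sum => i; case: (F0 i).
by apply: sumr_ge0 => i _; case: (F0 i).
Qed.

Lemma nnmeasurable_pow_ratio f g k : nnmeasurable f -> measurable_fun setT g ->
  (forall x, (0 < g x)%R) -> nnmeasurable (fun x => f x ^+ k.+1 / g x ^+ k)%R.
Proof.
move=> [mf f0] mg g0; split => [|x]; last by rewrite divr_ge0 ?exprn_ge0// ltW.
apply: measurable_funM; first exact: measurable_funX.
by apply: measurable_funV_gt0 => [|x]; [exact: measurable_funX|rewrite exprn_gt0].
Qed.

Lemma nn_integralD f g : nnmeasurable f -> nnmeasurable g ->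
  \int[mu]_x (f x + g x)%:E = \int[mu]_x (f x)%:E + \int[mu]_x (g x)%:E.
Proof.
move=> [mf f0] [mg g0]; rewrite -ge0_integralD//; do ?exact/measurable_EFinP.
- by move=> x _; rewrite lee_fin.
- by move=> x _; rewrite lee_fin.
Qed.

Lemma nn_integralZ (c : R) f : (0 <= c)%R -> nnmeasurable f ->
  \int[mu]_x (c * f x)%:E = c%:E * \int[mu]_x (f x)%:E.
Proof.
move=> c0 [mf f0]; rewrite -ge0_integralZl//; do ?exact/measurable_EFinP.
by move=> x _; rewrite lee_fin.
Qed.

Lemma nn_integral_sum (I : Type) (r : seq I) (F : I -> T -> R) :
  (forall i, nnmeasurable (F i)) ->
  \int[mu]_x (\sum_(i <- r) F i x)%:E = \sum_(i <- r) \int[mu]_x (F i x)%:E.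
Proof.
move=> F0; elim: r => [|i r IH].
  by under eq_integral do rewrite big_nil; rewrite big_nil integral0.
under eq_integral do rewrite big_cons.
by rewrite big_cons nn_integralD ?IH//; exact: nnmeasurable_sum.
Qed.

Lemma nn_le_integral f g : nnmeasurable f -> nnmeasurable g ->
  (forall x, (f x <= g x)%R) -> \int[mu]_x (f x)%:E <= \int[mu]_x (g x)%:E.
Proof.
move=> [mf f0] [mg g0] fg; apply: ge0_le_integral => //; do ?exact/measurable_EFinP.
- by move=> x _; rewrite lee_fin.
- by move=> x _; rewrite lee_fin.
Qed.

End nnmeasurable_integral.

Section gaussian_moments.
Context {R : realType} {p : nat} (s : R).
Hypothesis s0 : s != 0.
Local Open Scope ereal_scope.
Local Notation N := (gauss_rV s p).
Local Notation w := (@gauss_tilt R s p).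

Lemma gauss_tilt_gt0 (v g : 'rV[R]_p) : (0 < w v g)%R.
Proof. exact: expR_gt0. Qed.

Lemma nnmeasurable_gauss_tilt (v : 'rV[R]_p) : nnmeasurable (w v).
Proof.
split=> [|x]; last exact/ltW/gauss_tilt_gt0.
exact: (measurable_gauss_tilt s (v := cst v) (g := id)).
Qed.

Lemma integral_gauss_tilt (v : 'rV[R]_p) : \int[N]_g (w v g)%:E = 1.
Proof.
have := @ge0_integral_gauss_translate R s p v (cst 1) s0 (measurable_cst _)
  (fun=> lee01).
rewrite integral_cst// mul1e => h; rewrite -(@probability_setT _ _ _ N) h.
by apply: eq_integral => g _; rewrite mul1e.
Qed.

(** Completing the square: up to a constant factor the quotient is again a tilt, now by
    [k.+1%:R *: u - k%:R *: v]. Since tilts integrate to 1, the constant is the whole moment. *)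
Lemma gauss_tilt_pow_ratioE (k : nat) (u v g : 'rV[R]_p) :
  (w u g ^+ k.+1 / w v g ^+ k = expR (k.+1%:R * k%:R * l2norm (u - v) ^+ 2 / (2 * s ^+ 2)) *
    w (k.+1%:R *: u - k%:R *: v) g)%R.
Proof.
rewrite /gauss_tilt -!expRM_natl -expRN -!expRD; congr expR.
rewrite sqr_sqrtr; last by apply: sumr_ge0 => i _; exact: sqr_ge0.
rewrite -natr1 !mulr_sumr mulr_suml -sumrB -big_split/=; apply: eq_bigr => i _.
by rewrite !mxE; field.
Qed.

Lemma integral_gauss_tilt_pow_ratio_le (k : nat) (D : R) (u v : 'rV[R]_p) :
  (l2norm (u - v) <= D)%R ->
  \int[N]_g (w u g ^+ k.+1 / w v g ^+ k)%:E <=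
  (expR (k%:R * (k.+1%:R * D ^+ 2 / (2 * s ^+ 2))))%:E.
Proof.
move=> uvD; under eq_integral do rewrite gauss_tilt_pow_ratioE.
rewrite nn_integralZ ?expR_ge0//; last exact: nnmeasurable_gauss_tilt.
rewrite integral_gauss_tilt mule1 lee_fin ler_expR mulrA.
rewrite [leRHS](_ : _ = k.+1%:R * k%:R * D ^+ 2 / (2 * s ^+ 2))%R; last by ring.
apply: ler_wpM2r; first by rewrite invr_ge0 mulr_ge0// sqr_ge0.
apply: ler_wpM2l; first by rewrite mulr_ge0.
by rewrite lerXn2r ?nnegrE ?sqrtr_ge0//; exact: le_trans (sqrtr_ge0 _) uvD.
Qed.

Variables (D : R) (u v z : 'rV[R]_p).
Hypotheses (uzD : (l2norm (u - z) <= D)%R) (vzD : (l2norm (v - z) <= D)%R).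

Let mnu := nnmeasurable_gauss_tilt.

Lemma nnmeasurable_gauss_tilt_normB_ratio k :
  nnmeasurable (fun g => `|w u g - w v g| ^+ k.+1 / w z g ^+ k)%R.
Proof.
apply: (nnmeasurable_pow_ratio (f := fun g => `|w u g - w v g|%R)).
- split=> [|x]; last exact: normr_ge0.
  apply: measurableT_comp => //; apply: measurable_funB; exact: (mnu _).1.
- exact: (mnu _).1.
- by move=> x; exact: gauss_tilt_gt0.
Qed.

Let mnr x k : nnmeasurable (fun g => w x g ^+ k.+1 / w z g ^+ k)%R.
Proof.
by apply: nnmeasurable_pow_ratio => // [|g]; [exact: (mnu _).1|exact: gauss_tilt_gt0].
Qed.

Lemma integral_gauss_tilt_normB_ratio_le (k : nat) :
  \int[N]_g (`|w u g - w v g| ^+ k.+1 / w z g ^+ k)%:E <=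
  (2 * expR (k%:R * (k.+1%:R * D ^+ 2 / (2 * s ^+ 2))))%:E.
Proof.
apply: (@le_trans _ _ (\int[N]_g
    (w u g ^+ k.+1 / w z g ^+ k + w v g ^+ k.+1 / w z g ^+ k)%:E)).
  apply: nn_le_integral; first exact: nnmeasurable_gauss_tilt_normB_ratio.
    exact: nnmeasurableD.
  move=> g; rewrite -mulrDl ler_wpM2r ?invr_ge0 ?exprn_ge0 ?(ltW (gauss_tilt_gt0 _ _))//.
  by apply: normB_pow_le; apply/ltW/gauss_tilt_gt0.
rewrite nn_integralD// mulr2n mulrDl !mul1r EFinD.
by apply: leeD; exact: integral_gauss_tilt_pow_ratio_le.
Qed.

(** Parallelogram identity around [z]: the square of [u - v] is at most twice the sum of the squares
    of [u - z] and [v - z], and each of these, divided by [z], integrates to at most [e - 1]. *)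
Lemma integral_gauss_tilt_normB_ratio2_le :
  \int[N]_g (`|w u g - w v g| ^+ 2 / w z g ^+ 1)%:E <=
  (4 * (expR (2 * D ^+ 2 / (2 * s ^+ 2)) - 1))%:E.
Proof.
have hu := integral_gauss_tilt_pow_ratio_le 1 uzD.
have hv := integral_gauss_tilt_pow_ratio_le 1 vzD.
rewrite !mul1r in hu hv.
set e := expR _ in hu hv *.
have := @nn_le_integral _ _ _ N
  (fun g => `|w u g - w v g| ^+ 2 / w z g ^+ 1 + (4 * w u g + 4 * w v g))%R
  (fun g => 2 * (w u g ^+ 2 / w z g ^+ 1) + (2 * (w v g ^+ 2 / w z g ^+ 1) + 4 * w z g))%R.
have m1 := nnmeasurable_gauss_tilt_normB_ratio 1.
have m2 x : nnmeasurable (fun g => 4 * w x g)%R by exact: nnmeasurableZ.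
have m3 x : nnmeasurable (fun g => 2 * (w x g ^+ 2 / w z g ^+ 1))%R.
  exact: nnmeasurableZ (mnr _ 1).
have m4 : nnmeasurable (fun g => 4 * w u g + 4 * w v g)%R by exact: nnmeasurableD.
have m5 : nnmeasurable (fun g => 2 * (w v g ^+ 2 / w z g ^+ 1) + 4 * w z g)%R.
  exact: nnmeasurableD.
move=> /(_ (nnmeasurableD m1 m4) (nnmeasurableD (m3 _) m5)).
rewrite !nn_integralD// !nn_integralZ//; do ?exact: (mnr _ 1).
rewrite !integral_gauss_tilt !mule1.
(* The inequality is arranged with nonnegative terms on both sides; integrated, it reads
   [I + 8 <= 2 * e + 2 * e + 4], for [I] the integral to be bounded. *)
have pt g : (`|w u g - w v g| ^+ 2 / w z g ^+ 1 + (4 * w u g + 4 * w v g) <=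
    2 * (w u g ^+ 2 / w z g ^+ 1) + (2 * (w v g ^+ 2 / w z g ^+ 1) + 4 * w z g))%R.
  have z0 := gauss_tilt_gt0 z g; rewrite expr1 real_normK ?num_real//.
  rewrite -subr_ge0 [leRHS](_ : _ = (w u g + w v g - 2 * w z g) ^+ 2 / w z g)%R.
    by rewrite divr_ge0 ?sqr_ge0// ltW.
  by field; rewrite gt_eqF.
move=> /(_ pt).
have : 0 <= \int[N]_g (`|w u g - w v g| ^+ 2 / w z g ^+ 1)%:E.
  by apply: integral_ge0 => g _; rewrite lee_fin m1.2.
have : 0 <= \int[N]_g (w u g ^+ 2 / w z g ^+ 1)%:E.
  by apply: integral_ge0 => g _; rewrite lee_fin (mnr _ 1).2.
have : 0 <= \int[N]_g (w v g ^+ 2 / w z g ^+ 1)%:E.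
  by apply: integral_ge0 => g _; rewrite lee_fin (mnr _ 1).2.
move: hu hv; case: (\int[N]_g (w u g ^+ 2 / _)%:E) => [a| |]//.
case: (\int[N]_g (w v g ^+ 2 / _)%:E) => [b| |]//.
case: (integral _ _ _) => [c| |]//; rewrite -?EFinM -?EFinD ?lee_fin => *; lra.
Qed.

End gaussian_moments.

Section mixture_moment.
Context {R : realType} {p : nat} (s D c : R) (I : finType) (u v z : I -> 'rV[R]_p).
Hypotheses (s0 : s != 0) (c0 : 0 <= c) (I0 : (0 < #|I|)%N).
Hypotheses (uzD : forall i, l2norm (u i - z i) <= D).
Hypotheses (vzD : forall i, l2norm (v i - z i) <= D).
Local Notation N := (gauss_rV s p).
Local Notation w := (@gauss_tilt R s p).
Variables (P Q : 'rV[R]_p -> R).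
Hypotheses (mP : nnmeasurable P) (P1 : (\int[N]_g (P g)%:E = 1)%E).
Hypothesis QE : forall g, Q g = #|I|%:R^-1 * \sum_i w (z i) g.
Hypothesis PQE : forall g,
  P g - Q g = c * (#|I|%:R^-1 * \sum_i (w (u i) g - w (v i) g)).

Let nI0 : 0 < (#|I|%:R : R). Proof. by rewrite ltr0n. Qed.

Let Q0 g : 0 < Q g.
Proof.
rewrite QE mulr_gt0 ?invr_gt0//; have /card_gt0P[i _] := I0.
rewrite (bigD1 i)//= ltr_pwDl ?gauss_tilt_gt0// sumr_ge0// => j _.
exact/ltW/gauss_tilt_gt0.
Qed.

Let mQ : nnmeasurable Q.
Proof.
rewrite (_ : Q = fun g => #|I|%:R^-1 * \sum_i w (z i) g); last exact/funext.
apply: nnmeasurableZ; first by rewrite invr_ge0.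
by apply: nnmeasurable_sum => i; exact: nnmeasurable_gauss_tilt.
Qed.

Let Q1 : (\int[N]_g (Q g)%:E = 1)%E.
Proof.
under eq_integral do rewrite QE.
rewrite nn_integralZ ?invr_ge0//; last first.
  by apply: nnmeasurable_sum => i; exact: nnmeasurable_gauss_tilt.
rewrite nn_integral_sum; last by move=> i; exact: nnmeasurable_gauss_tilt.
under eq_bigr do rewrite integral_gauss_tilt//.
by rewrite sumEFin -EFinM sumr_const mulVf// gt_eqF.
Qed.

(** The perspective inequality for [|w (u i) g - w (v i) g|] over [w (z i) g]. Numerator and
    denominator are averages over the same index set, so of the normalising powers of [#|I|] a
    single one remains. *)
Let term_le (k : nat) g : `|P g - Q g| ^+ k.+1 / Q g ^+ k <=
  c ^+ k.+1 * (#|I|%:R^-1 * \sum_i (`|w (u i) g - w (v i) g| ^+ k.+1 / w (z i) g ^+ k)).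
Proof.
set S := \sum_i `|w (u i) g - w (v i) g|.
have S0 : 0 <= S by exact: sumr_ge0.
have hS : `|P g - Q g| <= c * (#|I|%:R^-1 * S).
  rewrite PQE !normrM (ger0_norm c0) ler_wpM2l// ger0_norm ?invr_ge0// ler_wpM2l ?invr_ge0//.
  exact: ler_norm_sum.
apply: (@le_trans _ _ ((c * (#|I|%:R^-1 * S)) ^+ k.+1 / Q g ^+ k)).
  rewrite ler_wpM2r ?invr_ge0 ?exprn_ge0 ?(ltW (Q0 _))// lerXn2r ?nnegrE//.
  by rewrite !mulr_ge0 ?invr_ge0.
have := @perspective_sum_le _ I (fun i => `|w (u i) g - w (v i) g|) (fun i => w (z i) g) k
  (fun=> normr_ge0 _) (fun=> gauss_tilt_gt0 _ _ _) I0; rewrite -/S.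
have Ninv0 : 0 <= (#|I|%:R^-1 : R) by rewrite invr_ge0.
move=> /(ler_wpM2l Ninv0)/(ler_wpM2l (exprn_ge0 k.+1 c0)); apply: le_trans.
rewrite QE; set W := \sum_i w (z i) g.
have W0 : 0 < W by have := Q0 g; rewrite QE pmulr_rgt0// invr_gt0.
suff -> : (c * (#|I|%:R^-1 * S)) ^+ k.+1 / (#|I|%:R^-1 * W) ^+ k =
    c ^+ k.+1 * (#|I|%:R^-1 * (S ^+ k.+1 / W ^+ k)) by [].
rewrite !exprMn (exprS #|I|%:R^-1).
have : (#|I|%:R^-1 : R) ^+ k != 0 by rewrite expf_neq0// invr_eq0 gt_eqF.
have : W ^+ k != 0 by rewrite expf_neq0// gt_eqF.
move: (W ^+ k) (#|I|%:R^-1 ^+ k) (c ^+ k.+1) (S ^+ k.+1) => x t y0 y1 x0 t0.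
by field; rewrite x0 t0 gt_eqF.
Qed.

Let e (k : nat) : R := expR (k%:R * (k.+1%:R * D ^+ 2 / (2 * s ^+ 2))).

Let int_term_le (k : nat) (B : R) : 0 <= B ->
  (forall i, \int[N]_g (`|w (u i) g - w (v i) g| ^+ k.+1 / w (z i) g ^+ k)%:E <= B%:E)%E ->
  (\int[N]_g (`|P g - Q g| ^+ k.+1 / Q g ^+ k)%:E <= (c ^+ k.+1 * B)%:E)%E.
Proof.
move=> B0 hB.
have mt i := nnmeasurable_gauss_tilt_normB_ratio s (u i) (v i) (z i) k.
have ms : nnmeasurable (fun g => #|I|%:R^-1 *
    \sum_i (`|w (u i) g - w (v i) g| ^+ k.+1 / w (z i) g ^+ k)).
  by apply: nnmeasurableZ; [rewrite invr_ge0|exact: nnmeasurable_sum].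
apply: le_trans (nn_le_integral N _ (nnmeasurableZ (exprn_ge0 k.+1 c0) ms) (term_le k)) _.
  apply: (nnmeasurable_pow_ratio (f := fun g => `|P g - Q g|)) => //; last exact: mQ.1.
  split=> [|x]; last exact: normr_ge0.
  by apply: measurableT_comp => //; apply: measurable_funB; [exact: mP.1|exact: mQ.1].
rewrite nn_integralZ ?exprn_ge0// EFinM lee_wpmul2l ?lee_fin ?exprn_ge0//.
rewrite nn_integralZ ?invr_ge0//; last exact: nnmeasurable_sum.
rewrite nn_integral_sum//.
apply: (@le_trans _ _ (#|I|%:R^-1%:E * \sum_(i : I) B%:E)%E).
  by rewrite lee_wpmul2l ?lee_fin ?invr_ge0// lee_sum.
by rewrite sumEFin -EFinM sumr_const -(mulr_natl B) mulKf// gt_eqF.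
Qed.

(** Integrate [ratio_pow_binomial_le]: as [P] and [Q] have mass 1, the linear terms cancel. The term
    of degree 2 has two available bounds, whence the minimum; the higher ones use the bound with
    factor 2. *)
Lemma mixture_moment_le (a : nat) : (1 < a)%N ->
  (\int[N]_g (P g ^+ a / Q g ^+ a.-1)%:E <=
   (1 + c ^+ 2 * 'C(a, 2)%:R * Num.min (4 * (e 1 - 1)) (2 * e 1) +
    \sum_(3 <= j < a.+1) c ^+ j * 'C(a, j)%:R * 2 * e j.-1)%:E)%E.
Proof.
move=> a1; have a0 : (0 < a)%N by exact: ltnW.
(* The lemmas on sums ask for all natural indices, so index 0 is covered too, although it is outside
   the range of summation; there the function is constantly 1. *)
have mterm k : nnmeasurable (fun g => `|P g - Q g| ^+ k / Q g ^+ k.-1).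
  case: k => [|k].
    split=> [|g]; rewrite ?expr0 ?divr1// (_ : (fun _ => _) = cst 1) ?divr1//.
    by apply/funext => g; rewrite !expr0 divr1.
  apply: (nnmeasurable_pow_ratio (f := fun g => `|P g - Q g|)) => //; last exact: mQ.1.
  split=> [|x]; last exact: normr_ge0.
  by apply: measurableT_comp => //; apply: measurable_funB; [exact: mP.1|exact: mQ.1].
have mPQ : nnmeasurable (fun g => P g ^+ a / Q g ^+ a.-1).
  by rewrite -(prednK a0); apply: nnmeasurable_pow_ratio => //; exact: mQ.1.
have mCt (j : nat) : nnmeasurable (fun g => 'C(a, j)%:R * (`|P g - Q g| ^+ j / Q g ^+ j.-1)).
  by apply: nnmeasurableZ.
have maQ : nnmeasurable (fun g => a%:R * Q g) by exact: nnmeasurableZ.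
have maP : nnmeasurable (fun g => a%:R * P g) by exact: nnmeasurableZ.
have msum : nnmeasurable (fun g => \sum_(2 <= j < a.+1)
    'C(a, j)%:R * (`|P g - Q g| ^+ j / Q g ^+ j.-1)) by exact: nnmeasurable_sum.
have := nn_le_integral N (nnmeasurableD mPQ maQ)
  (nnmeasurableD (nnmeasurableD mQ maP) msum)
  (fun g => ratio_pow_binomial_le (P g) a0 (Q0 g)).
rewrite !nn_integralD//; last exact: nnmeasurableD.
rewrite !nn_integralZ// P1 Q1 nn_integral_sum//.
have e0 k : 1 <= e k.
  rewrite /e -expR0 ler_expR; apply: mulr_ge0 => //.
  by apply: divr_ge0; rewrite mulr_ge0// sqr_ge0.
set M := (\int[N]_g (P g ^+ a / _)%:E)%E; set X := (\sum_(2 <= j < a.+1) _)%E => hM.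
have M0 : (0 <= M)%E by apply: integral_ge0 => g _; rewrite lee_fin mPQ.2.
suff : (X <= (c ^+ 2 * 'C(a, 2)%:R * Num.min (4 * (e 1 - 1)) (2 * e 1) +
    \sum_(3 <= j < a.+1) c ^+ j * 'C(a, j)%:R * 2 * e j.-1)%:E)%E.
  (* Both sides contain [a], which may be cancelled because the bound on [X] excludes an infinite
     [M]. *)
  move: M0 hM; case: M => [M| |]//; case: X => [X| |]// _.
  by rewrite !mule1 -!EFinD !lee_fin => *; lra.
rewrite /X big_ltn// EFinD; apply: leeD.
  rewrite nn_integralZ// (mulrC (c ^+ 2)) -mulrA EFinM lee_wpmul2l ?lee_fin//.
  apply: int_term_le.
    by rewrite le_min !mulr_ge0 ?subr_ge0// (le_trans _ (e0 1)).
  move=> i; rewrite EFin_min le_min; apply/andP; split.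
    by have := integral_gauss_tilt_normB_ratio2_le s0 (uzD i) (vzD i); rewrite /e mul1r.
  exact: integral_gauss_tilt_normB_ratio_le.
rewrite -sumEFin big_nat_cond [leRHS]big_nat_cond; apply: lee_sum => j /andP[/andP[j3 ja] _].
rewrite nn_integralZ// (mulrC (c ^+ j)) -!mulrA EFinM lee_wpmul2l ?lee_fin//.
case: j j3 {ja} => // k _; apply: int_term_le => [|i].
  by rewrite mulr_ge0// (le_trans _ (e0 _)).
exact: integral_gauss_tilt_normB_ratio_le.
Qed.

End mixture_moment.

(** * Independence along the chain *)

Lemma measure_partition d (T : measurableType d) (R : realType)
    (mu : {measure set T -> \bar R}) (I : finType) (f : T -> I) (X : set T) :
  (forall i, measurable [set w | f w = i]) -> measurable X ->
  mu X = (\sum_i mu (X `&` [set w | f w = i]))%E.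
Proof.
move=> mf mX.
have key (r : seq I) : uniq r -> measurable [set w | f w \in r] /\
    mu (X `&` [set w | f w \in r]) = (\sum_(i <- r) mu (X `&` [set w | f w = i]))%E.
  elim: r => [_|i r IH /= /andP[ir /IH[mr IHr]]].
    by rewrite big_nil (_ : [set _ | _] = set0) ?setI0 ?measure0//;
      apply/seteqP; split.
  have E : [set w | f w \in i :: r] = [set w | f w = i] `|` [set w | f w \in r].
    apply/seteqP; split => w /=; rewrite inE; first by case/orP => [/eqP|]; [left|right].
    by case=> [->|->]; rewrite ?eqxx ?orbT.
  split; first by rewrite E; exact: measurableU.
  rewrite E setIUr big_cons -IHr; apply: measureU; do ?exact: measurableI.
  by apply/seteqP; split => // w /= [[_ wi] [_]]; rewrite wi (negbTE ir).
have [_ <-] := key _ (index_enum_uniq I).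
congr (mu _); apply/seteqP; split => [w Xw|w []//]; split => //=.
by rewrite mem_index_enum.
Qed.

(** One index for each batch and one for each scalar noise coordinate; the form is convertible to
    the family in the independence hypothesis of the theorem. *)
Definition noise_events {R : realType} {Omega : Type} {Bt : finType} {p T : nat}
    (B : nat -> Omega -> Bt) (gam : nat -> 'I_p -> Omega -> R)
    (j : 'I_T + ('I_T * 'I_p)) : set (set Omega) :=
  match j with
  | inl k => [set E | exists SS : set Bt, E = B k @^-1` SS]
  | inr (k, i) => [set E | exists A : set R, measurable A /\ E = gam k i @^-1` A]
  end.

Section noisy_chain.
Context {R : realType} {d} {Omega : measurableType d} (P : probability Omega R).
Context {dS} {S : measurableType dS} {Bt : finType} {p : nat} (T : nat) (s : R).
Variables (B : nat -> Omega -> Bt) (gam : nat -> 'I_p -> Omega -> R).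
Hypothesis B_meas : forall k b, (k < T)%N -> measurable [set w | B k w = b].
Hypothesis gam_meas : forall k i, (k < T)%N -> measurable_fun setT (gam k i).
Hypothesis gam_gauss : forall k i, (k < T)%N -> forall A : set R, measurable A ->
  P (gam k i @^-1` A) = normal_prob 0 s A.
Hypothesis indep : mutually_independent P (@noise_events R Omega Bt p T B gam).
Variables (step : nat -> Bt -> S -> 'rV[R]_p -> S) (st0 : S).
Hypothesis step_meas : forall k b,
  measurable_fun setT (fun z : S * 'rV[R]_p => step k b z.1 z.2).

Definition noise k w : 'rV[R]_p := \row_i gam k i w.

Fixpoint chain (k : nat) (w : Omega) : S :=
  if k is k'.+1 then step k' (B k' w) (chain k' w) (noise k' w) else st0.

Lemma measurable_noise k : (k < T)%N -> measurable_fun setT (noise k).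
Proof.
move=> kT; apply/measurable_fun_rVP => i.
by apply: eq_measurable_fun (gam_meas i kT) => w _; rewrite mxE.
Qed.

(** [step] is measurable only for a fixed batch, so the preimage is cut along the finitely many
    values of [B k]. *)
Lemma measurable_chain k : (k <= T)%N -> measurable_fun setT (chain k).
Proof.
elim: k => [_|k IH kT] /=; first exact: measurable_cst.
move=> _ A mA; rewrite setTI.
pose X b := [set w | B k w = b] `&`
  (fun w => step k b (chain k w) (noise k w)) @^-1` A.
rewrite (_ : _ @^-1` A = \bigcup_b X b); last first.
  apply/seteqP; split => [w /= Aw|w [b _ [/= <-]]//].
  by exists (B k w) => //; split.
apply: countable_bigcupT_measurable => [|b]; first exact: countableP.
apply: measurableI; first exact: B_meas.
rewrite -[X in measurable X]setTI.
have mp : measurable_fun setT (fun w => (chain k w, noise k w)).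
  by apply: measurable_fun_pair; [exact/IH/ltnW|exact: measurable_noise].
exact: (measurableT_comp (step_meas k b) mp).
Qed.

Let time (j : 'I_T + ('I_T * 'I_p)) : nat :=
  match j with inl k => k | inr (k, _) => k end.

Let measurable_noise_event (j : 'I_T + ('I_T * 'I_p)) E : noise_events B gam j E -> measurable E.
Proof.
case: j => [k [SS ->]|[k i] [A [mA ->]]].
  rewrite (_ : _ @^-1` _ = \bigcup_(b in SS) [set w | B k w = b]).
    rewrite bigcup_mkcond; apply: countable_bigcupT_measurable => [|b].
      exact: countableP.
    by case: ifP => // _; exact: B_meas.
  by apply/seteqP; split => [w /= SSw|w [b SSb /= ->]//]; exists (B k w).
by rewrite -[X in measurable X]setTI; exact: gam_meas.
Qed.

(** The invariant of the induction: the state at time [k] is independent of all draws from time [k]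
    on. Families that are trivial before time [k] encode joint events of those draws. *)
Let indep_future k := forall A (E : 'I_T + ('I_T * 'I_p) -> set Omega), measurable A ->
  (forall j, noise_events B gam j (E j)) ->
  (forall j, (time j < k)%N -> E j = setT) ->
  P (chain k @^-1` A `&` \bigcap_(j in setT) E j) =
  (P (chain k @^-1` A) * \prod_j P (E j))%E.

Let measurable_bigcap_event (E : 'I_T + ('I_T * 'I_p) -> set Omega) :
  (forall j, noise_events B gam j (E j)) ->
  measurable (\bigcap_(j in [set: 'I_T + ('I_T * 'I_p)]) E j).
Proof.
move=> hE; apply: fin_bigcap_measurable => // j _.
exact: measurable_noise_event (hE j).
Qed.

Let noise_eventT (j : 'I_T + ('I_T * 'I_p)) : noise_events B gam j setT.
Proof.
by case: j => [k|[k i]]; exists setT; [|split => //]; rewrite preimage_setT.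
Qed.

(* Both sides are finite measures in [Z], so it is enough to compare them on boxes. *)
Let joint_step k (kT : (k < T)%N) b (E : 'I_T + ('I_T * 'I_p) -> set Omega)
    (mu : probability S R) : indep_future k ->
  (forall A, measurable A -> mu A = P (chain k @^-1` A)) ->
  (forall j, noise_events B gam j (E j)) ->
  (forall j, (time j < k.+1)%N -> E j = setT) ->
  forall Z, measurable Z ->
  P ((fun w => (chain k w, noise k w)) @^-1` Z `&`
     ([set w | B k w = b] `&` \bigcap_(j in setT) E j)) =
  (P [set w | B k w = b] * \prod_j P (E j) * (mu \x gauss_rV s p) Z)%E.
Proof.
move=> IH muE hE ET.
have mB : measurable [set w | B k w = b] by exact: B_meas.
pose D := [set w | B k w = b] `&` \bigcap_(j in setT) E j.
have mD : measurable D by apply: measurableI => //; exact: measurable_bigcap_event.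
pose f w : S * 'rV[R]_p := (chain k w, noise k w).
have mp : measurable_fun setT f.
  by apply: measurable_fun_pair; [exact/measurable_chain/ltnW|exact: measurable_noise].
pose mix := isMeasurableFun.Build _ _ _ _ _ mp.
pose f' : {mfun Omega >-> (S * 'rV[R]_p)%type} := HB.pack f mix.
(* Restricting [P] to [D] before pushing it forward turns the left-hand side into a measure in
   [Z]. *)
pose m1_ : {measure set (S * 'rV[R]_p) -> \bar R} := pushforward (mrestr P mD) f'.
pose m1 := m1_ mp.
pose c : \bar R := (P [set w | B k w = b] * \prod_j P (E j))%E.
have c0 : (0 <= c)%E by rewrite mule_ge0// prode_ge0.
have cfin : c \is a fin_num.
  rewrite fin_numM ?fin_num_measure//; apply: (big_ind (fun x => x \is a fin_num)) => //.
    by move=> x y; exact: fin_numM.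
  by move=> j _; rewrite fin_num_measure//; exact: measurable_noise_event (hE j).
have c0' : 0 <= fine c by exact: fine_ge0.
pose m2 : {measure set (S * 'rV[R]_p) -> \bar R} :=
  mscale (NngNum c0') (mu \x gauss_rV s p)%E.
have m1E Z : m1 Z = P (f @^-1` Z `&` D) by [].
have m2E Z : m2 Z = (c * (mu \x gauss_rV s p) Z)%E by rewrite -[in RHS](fineK cfin).
suff H Z : measurable Z -> m1 Z = m2 Z.
  by move=> Z mZ; rewrite -/D -/c -/f -m1E -m2E H.
move: Z; apply: measure_prod_rV_eq.
  by rewrite m1E preimage_setT setTI (le_lt_trans (probability_le1 P mD)) ?ltry.
move=> A G mA mG; rewrite m1E m2E product_measure1E//; last exact: measurable_rV_box.
apply: (etrans _ (congr1 (fun x => c * (mu A * x))%E (esym (gauss_rV_box s mG)))).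
cbv beta.
(* The time-[k] events, trivial in [E], are replaced in [E'] by the batch event and the sides of the
   box. [E'] remains trivial before time [k], so the induction hypothesis covers it. *)
pose kk : 'I_T := Ordinal kT.
pose E' j : set Omega := match j with
  | inl k' => if k' == kk then [set w | B k w = b] else E j
  | inr (k', i) => if k' == kk then gam k i @^-1` G i else E j end.
have hE' j : noise_events B gam j (E' j).
  rewrite /E'; case: j => [k'|[k' i]]; case: eqP => [->|_]; do ?exact: hE.
    by exists [set b].
  by exists (G i); split.
have E'T j : (time j < k)%N -> E' j = setT.
  rewrite /E'; case: j => [k'|[k' i]] /= jk.
    by case: eqP => [k'k|_]; [move: jk; rewrite k'k/= ltnn|apply: ET; exact: ltnW].
  by case: eqP => [k'k|_]; [move: jk; rewrite k'k/= ltnn|apply: ET; exact: ltnW].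
transitivity (P (chain k @^-1` A `&` \bigcap_(j in setT) E' j)).
  congr (P _); apply/seteqP; split => w /=.
    move=> [[Aw Gw] [Bw Ew]]; split => // -[k'|[k' i]] _ /=; case: eqP => // _; do ?exact: Ew.
    by have := Gw i; rewrite mxE.
  move=> [Aw E'w]; split.
    split => // i; have := E'w (inr (kk, i)) Logic.I; rewrite /= eqxx.
    by rewrite mxE.
  split; first by have := E'w (inl kk) Logic.I; rewrite /= eqxx.
  move=> j _; have := E'w j Logic.I; case: j => [k'|[k' i]] /=; case: eqP => // k'k _.
    by rewrite ET//= k'k.
  by rewrite ET//= k'k.
rewrite IH// -muE// [RHS]muleC -muleA; congr (_ * _)%E.
rewrite muleC /c -muleA.
rewrite !big_sumType/=.
(* The products over [E'] and [E] differ only at [kk], where the factors of [E] equal 1. *)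
have -> : (\prod_(k' < T) P (E' (inl k')) =
    P [set w | B k w = b] * \prod_(k' < T) P (E (inl k')))%E.
  rewrite (bigD1 kk)//= eqxx; congr (_ * _)%E.
  rewrite [RHS](bigD1 kk)//= (ET (inl kk))// probability_setT mul1e.
  by apply: eq_bigr => k' /negbTE ->.
have -> : (\prod_(z : 'I_T * 'I_p) P (E' (inr z)) =
    (\prod_(i < p) normal_prob 0 s (G i)) * \prod_(z : 'I_T * 'I_p) P (E (inr z)))%E.
  have pairE (H : 'I_T * 'I_p -> set Omega) : (\prod_(z : 'I_T * 'I_p) P (H z) =
      \prod_(k' < T) \prod_(i < p) P (H (k', i)))%E.
    by rewrite pair_bigA; apply: eq_bigr => -[].
  rewrite !pairE (bigD1 kk)//= [X in (_ = _ * X)%E](bigD1 kk)//=.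
  rewrite [X in (_ = _ * (X * _))%E]big1 ?mul1e; last first.
    by move=> i _; rewrite (ET (inr (kk, i)))// probability_setT.
  congr (_ * _)%E; first by apply: eq_bigr => i _; rewrite eqxx gam_gauss.
  by apply: eq_bigr => k' /negbTE k'k; apply: eq_bigr => i _; rewrite k'k.
by rewrite -!muleA; do 2 congr (_ * _)%E; exact: muleC.
Qed.

Let chain_step_sum k (kT : (k < T)%N) (E : 'I_T + ('I_T * 'I_p) -> set Omega)
    (mu : probability S R) : indep_future k ->
  (forall A, measurable A -> mu A = P (chain k @^-1` A)) ->
  (forall j, noise_events B gam j (E j)) ->
  (forall j, (time j < k.+1)%N -> E j = setT) ->
  forall A, measurable A ->
  P (chain k.+1 @^-1` A `&` \bigcap_(j in setT) E j) =
  ((\sum_b P [set w | B k w = b] *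
     (mu \x gauss_rV s p) [set z | A (step k b z.1 z.2)]) * \prod_j P (E j))%E.
Proof.
move=> IH muE hE ET A mA.
rewrite (measure_partition P (fun b => B_meas b kT)); last first.
  apply: measurableI; last exact: measurable_bigcap_event.
  by rewrite -[X in measurable X]setTI; exact: measurable_chain.
rewrite ge0_sume_distrl; last by move=> b _; rewrite mule_ge0.
apply: eq_bigr => b _.
have mZ : measurable [set z : S * 'rV[R]_p | A (step k b z.1 z.2)].
  by rewrite -[X in measurable X]setTI; exact: step_meas.
rewrite muleAC -(joint_step kT b IH muE hE ET mZ); congr (P _).
apply/seteqP; split => [w /= [[Aw Ew] Bw]|w /= [Aw [Bw Ew]]]; split => //.
  by rewrite -Bw.
by split => //; rewrite Bw.
Qed.

(** The first factor in [chain_step_sum] does not depend on [E]; taking all events trivial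
    identifies it as the probability that the next state lies in [A]. *)
Let indep_futureP k : (k <= T)%N -> indep_future k.
Proof.
elim: k => [_|k IH kT] A E mA hE ET.
  (* The initial state is constant, so the event is either everything or empty. *)
  rewrite [chain 0 @^-1` A](_ : _ = if pselect (A st0) then setT else set0); last first.
    by case: pselect => As; apply/seteqP; split => // w.
  by case: pselect => As; rewrite ?setTI ?set0I ?probability_setT ?measure0 ?mul1e ?mul0e ?indep.
have IH' := IH (ltnW kT).
pose mu := law P (measurable_chain (ltnW kT)).
have muE X : measurable X -> mu X = P (chain k @^-1` X) by [].
rewrite (chain_step_sum kT IH' muE hE ET mA); congr (_ * _)%E.
have := chain_step_sum kT IH' muE noise_eventT (fun _ _ => erefl) mA.
rewrite (_ : \bigcap_(j in _) _ = setT); last by apply/seteqP; split.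
by rewrite setIT [X in (_ = _ * X)%E]big1 ?mule1// => j _; exact: probability_setT.
Qed.

Lemma chain_law_step k (mu : probability S R) (A : set S) : (k < T)%N ->
  (forall A, measurable A -> mu A = P (chain k @^-1` A)) -> measurable A ->
  P (chain k.+1 @^-1` A) = (\sum_b P [set w | B k w = b] *
     (mu \x gauss_rV s p) [set z | A (step k b z.1 z.2)])%E.
Proof.
move=> kT muE mA.
have := chain_step_sum kT (indep_futureP (ltnW kT)) muE noise_eventT (fun _ _ => erefl) mA.
rewrite (_ : \bigcap_(j in _) _ = setT); last by apply/seteqP; split.
by rewrite setIT [X in (_ = _ * X)%E]big1 ?mule1// => j _; exact: probability_setT.
Qed.

End noisy_chain.

(** * Uniform batches *)

(** Double counting. For fixed [l], reindexing by the transposition turns [i \in J] into [l \in S],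
    so each [S] of size [m] is reached once for each of its [m] elements. *)
Lemma sum_swap (R : pzSemiRingType) n (i : 'I_n) (m : nat) (F : {set 'I_n} -> R) :
  \sum_(J : {set 'I_n} | (#|J| == m) && (i \in J))
    \sum_l F [set tperm i l x | x in J]%SET =
  m%:R * \sum_(S : {set 'I_n} | #|S| == m) F S.
Proof.
rewrite exchange_big/=.
transitivity (\sum_(l < n) \sum_(S : {set 'I_n} | #|S| == m) if l \in S then F S else 0).
  apply: eq_bigr => l _; rewrite -big_mkcondr/=.
  rewrite (reindex_inj (imset_inj (@perm_inj _ (tperm i l))))/=; apply: eq_big => S.
    rewrite card_imset; last exact: perm_inj.
    by congr (_ && _); rewrite -{1}(tpermR i l) mem_imset//; exact: perm_inj.
  move=> _; congr F; rewrite -imset_comp -[RHS]imset_id.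
  by apply: eq_imset => x /=; rewrite tpermK.
rewrite exchange_big/= mulr_sumr; apply: eq_bigr => S /eqP Sm.
by rewrite -big_mkcond/= sumr_const Sm mulr_natl.
Qed.

Section l2norm.
Context {R : realType} {p : nat}.
Implicit Types x y : 'rV[R]_p.

Lemma l2norm_le x (D : R) : 0 <= D -> (l2norm x <= D) = (\sum_i x ord0 i ^+ 2 <= D ^+ 2).
Proof.
move=> D0; rewrite /l2norm -[in LHS](ger0_norm D0) -sqrtr_sqr ler_sqrt//.
exact: sqr_ge0.
Qed.

(** The coordinatewise bound of the squared difference by twice the sum of squares is enough, since
    both norms are bounded by the same [C]. *)
Lemma l2normB_le x y (C D : R) : 0 <= C -> l2norm x <= C -> l2norm y <= C ->
  0 <= D -> l2norm (D *: (x - y)) <= D * (2 * C).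
Proof.
move=> C0 xC yC D0; move: xC yC; rewrite !l2norm_le ?mulr_ge0// => hx hy.
rewrite (@le_trans _ _ (\sum_i (D ^+ 2 * 2 * (x ord0 i ^+ 2 + y ord0 i ^+ 2))))//.
  apply: ler_sum => i _; rewrite !mxE -subr_ge0.
  rewrite [leRHS](_ : _ = (D * (x ord0 i + y ord0 i)) ^+ 2); last by ring.
  exact: sqr_ge0.
rewrite -mulr_sumr big_split/= [leRHS](_ : _ = D ^+ 2 * 2 * (C ^+ 2 + C ^+ 2)); last by ring.
by rewrite ler_wpM2l ?mulr_ge0 ?sqr_ge0// lerD.
Qed.

End l2norm.

Definition batch_mean {R : realType} {p n : nat} (m : nat) (h : 'I_n -> 'rV[R]_p)
  (S : {set 'I_n}) : 'rV[R]_p := m%:R^-1 *: \sum_(a in S) h a.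

(* The density, relative to the centred Gaussian law, of the noisy mean of
   a uniformly random batch of [m] vectors. *)
Definition batch_density {R : realType} {p n : nat} (s : R) (m : nat)
    (h : 'I_n -> 'rV[R]_p) (g : 'rV[R]_p) : R :=
  'C(n, m)%:R^-1 * \sum_(S : {set 'I_n} | #|S| == m) gauss_tilt s (batch_mean m h S) g.

(** The argument of the logarithm in [eps_prime]: the factor by which one iteration may increase the
    moment of order [alpha]. *)
Definition rdp_factor {R : realType} (C s : R) (n m alpha : nat) : R :=
  let q := m%:R / n%:R in
  1 + q ^+ 2 * 'C(alpha, 2)%:R *
        Num.min (4 * (expR (eps_j C s m 2) - 1)) (2 * expR (eps_j C s m 2)) +
  \sum_(3 <= j < alpha.+1)
     q ^+ j * 'C(alpha, j)%:R * 2 * expR ((j%:R - 1) * eps_j C s m j).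

(** * Moment of the density ratio for one noisy batch *)

Section batch_density_moment.
Context {R : realType} {p n : nat}.
Variables (s C : R) (m : nat) (i : 'I_n) (h h' : 'I_n -> 'rV[R]_p).
Hypotheses (s0 : s != 0) (C0 : 0 <= C) (mn : (0 < m <= n)%N).
Hypotheses (hC : forall a, l2norm (h a) <= C) (h'C : forall a, l2norm (h' a) <= C).
Hypothesis hh' : forall a, a != i -> h a = h' a.

Let n0 : (0 < n)%N. Proof. by case/andP: mn => /leq_trans; apply. Qed.
Let nR0 : 0 < (n%:R : R). Proof. by rewrite ltr0n. Qed.
Let mR0 : 0 < (m%:R : R). Proof. by rewrite ltr0n; case/andP: mn. Qed.
Let CR0 : 0 < ('C(n, m)%:R : R). Proof. by rewrite ltr0n bin_gt0; case/andP: mn. Qed.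

(** If [l] lies in [J], the exchange preserves [J] and only the values at [i] can differ; otherwise
    [i] is replaced by [l]. Either way the two sums differ by one vector minus another, both of norm
    at most [C]. *)
Let batch_mean_swap_dist (h1 : 'I_n -> 'rV[R]_p) (J : {set 'I_n}) l :
  (forall a, l2norm (h1 a) <= C) -> (forall a, a != i -> h1 a = h' a) -> i \in J ->
  l2norm (batch_mean m h1 J - batch_mean m h' [set tperm i l x | x in J]%SET) <=
  2 * C / m%:R.
Proof.
move=> h1C h1h' iJ; rewrite /batch_mean -scalerBr (mulrC _ m%:R^-1).
rewrite big_imset/=; last by move=> x y _ _; exact: perm_inj.
suff [y yC ->] : exists2 y, l2norm y <= C &
    \sum_(a in J) h1 a - \sum_(a in J) h' (tperm i l a) = h1 i - y.
  by apply: l2normB_le => //; rewrite invr_ge0 ltW.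
have [lJ|lJ] := boolP (l \in J).
  exists (h' i) => //.
  have -> : \sum_(a in J) h' (tperm i l a) = \sum_(a in J) h' a.
    rewrite [RHS](reindex_inj (@perm_inj _ (tperm i l)))/=; apply: eq_bigl => a.
    by case: tpermP => [->|->|//]; rewrite ?lJ ?iJ.
  rewrite (bigD1 i)//= [X in _ - X](bigD1 i)//= opprD addrACA -[RHS]addr0; congr +%R.
  by rewrite -sumrB big1// => a /andP[_ ai]; rewrite h1h'// subrr.
exists (h' l) => //.
rewrite (bigD1 i)//= [X in _ - X](bigD1 i)//= tpermL opprD addrACA -[RHS]addr0; congr +%R.
rewrite -sumrB big1// => a /andP[aJ ai]; rewrite tpermD ?h1h' ?subrr//.
  by rewrite eq_sym.
by apply: contraNneq lJ => ->.
Qed.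

Let Jp := [pred J : {set 'I_n} | (#|J| == m) && (i \in J)].
Let Idx : finType := ({J : {set 'I_n} | J \in Jp} * 'I_n)%type.

Let sum_Idx (F : {set 'I_n} -> 'I_n -> R) :
  \sum_(x : Idx) F (val x.1) x.2 =
  \sum_(J : {set 'I_n} | (#|J| == m) && (i \in J)) \sum_l F J l.
Proof.
by rewrite -(pair_bigA _ (fun J l => F (val J) l))/= -(big_sub Jp (fun J => \sum_l F J l)).
Qed.

(** [sum_swap] for the constant function 1 counts the pairs. *)
Let card_Idx : #|Idx|%:R = m%:R * 'C(n, m)%:R :> R.
Proof.
have := sum_swap i m (fun=> 1 : R); rewrite -(sum_Idx (fun _ _ => 1)).
rewrite !sumr_const => ->; congr (_ * _%:R).
by rewrite -[in RHS](card_ord n) -card_draws; apply: eq_card => S; rewrite !inE.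
Qed.

Let Idx0 : (0 < #|Idx|)%N.
Proof. by rewrite -(ltr0n R) card_Idx mulr_gt0. Qed.

Lemma nnmeasurable_batch_density (h1 : 'I_n -> 'rV[R]_p) :
  nnmeasurable (batch_density s m h1).
Proof.
apply: nnmeasurableZ; first by rewrite invr_ge0.
split=> [|g].
  under eq_fun do rewrite big_mkcond/=.
  apply: measurable_sum => S; case: (#|S| == m); last exact: measurable_cst.
  exact: (nnmeasurable_gauss_tilt _ _).1.
by apply: sumr_ge0 => S _; exact/ltW/gauss_tilt_gt0.
Qed.

Lemma batch_density_gt0 (h1 : 'I_n -> 'rV[R]_p) g : 0 < batch_density s m h1 g.
Proof.
rewrite mulr_gt0 ?invr_gt0//.
have /card_gt0P[S] : (0 < #|[set S : {set 'I_n} | #|S| == m]%SET|)%N.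
  by rewrite card_draws card_ord bin_gt0; case/andP: mn.
rewrite inE => Sm; rewrite (bigD1 S)//= ltr_pwDl ?gauss_tilt_gt0//.
by apply: sumr_ge0 => S' _; exact/ltW/gauss_tilt_gt0.
Qed.

Lemma integral_batch_density (h1 : 'I_n -> 'rV[R]_p) :
  (\int[gauss_rV s p]_g (batch_density s m h1 g)%:E = 1)%E.
Proof.
pose c (S : {set 'I_n}) : R := (#|S| == m)%:R.
have E g : batch_density s m h1 g =
    'C(n, m)%:R^-1 * \sum_(S : {set 'I_n}) c S * gauss_tilt s (batch_mean m h1 S) g.
  rewrite /batch_density big_mkcond/=; congr (_ * _); apply: eq_bigr => S _.
  by rewrite /c; case: ifP; rewrite ?mul1r ?mul0r.
have mc (S : {set 'I_n}) :
    nnmeasurable (fun g => c S * gauss_tilt s (batch_mean m h1 S) g).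
  by apply: nnmeasurableZ => //; exact: nnmeasurable_gauss_tilt.
under eq_integral do rewrite E.
rewrite nn_integralZ ?invr_ge0//; last exact: nnmeasurable_sum.
rewrite nn_integral_sum//.
under eq_bigr => S _.
  rewrite nn_integralZ//; last exact: nnmeasurable_gauss_tilt.
  rewrite integral_gauss_tilt// mule1; over.
rewrite sumEFin -EFinM /c -natr_sum; congr (_%:E).
rewrite (_ : (\sum_S _)%N = 'C(n, m)) ?mulVf// ?gt_eqF//.
rewrite -[in RHS](card_ord n) -card_draws -sum1_card [RHS]big_mkcond/=.
by apply: eq_bigr => S _; rewrite inE; case: eqP.
Qed.

(* Averaging over pairs (batch [J] containing [i], record [l]) and exchanging
   the records [i] and [l] couples a batch containing the differing record with a
   uniformly random batch that differs from it in at most one record. *)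
Lemma batch_density_moment_le (a : nat) : (1 < a)%N ->
  (\int[gauss_rV s p]_g (batch_density s m h g ^+ a / batch_density s m h' g ^+ a.-1)%:E <=
   (rdp_factor C s n m a)%:E)%E.
Proof.
move=> a1.
pose u (x : Idx) := batch_mean m h (val x.1).
pose v (x : Idx) := batch_mean m h' (val x.1).
pose z (x : Idx) := batch_mean m h' [set tperm i x.2 y | y in val x.1]%SET.
have iJ (x : Idx) : i \in val x.1 by have /andP[] := valP x.1.
have := @mixture_moment_le R p s (2 * C / m%:R) (m%:R / n%:R) Idx u v z s0
  (divr_ge0 (ltW mR0) (ltW nR0)) Idx0
  (fun x => batch_mean_swap_dist x.2 hC hh' (iJ x))
  (fun x => batch_mean_swap_dist x.2 h'C (fun _ _ => erefl) (iJ x))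
  (batch_density s m h) (batch_density s m h')
  (nnmeasurable_batch_density h) (integral_batch_density h).
have QE g : batch_density s m h' g = #|Idx|%:R^-1 * \sum_x gauss_tilt s (z x) g.
  rewrite (sum_Idx (fun J l => gauss_tilt s (batch_mean m h' [set tperm i l y | y in J]%SET) g)).
  rewrite (sum_swap i m (fun S => gauss_tilt s (batch_mean m h' S) g)) card_Idx.
  by rewrite invfM mulrACA mulVf ?mul1r// gt_eqF.
(* Batches without [i] have equal means and cancel. The sum over [l] repeats each remaining batch
   [n] times, so against the size [m * 'C(n, m)] of the index set the sampling rate [m / n] comes
   out. *)
have PQE g : batch_density s m h g - batch_density s m h' g = m%:R / n%:R *
    (#|Idx|%:R^-1 * \sum_x (gauss_tilt s (u x) g - gauss_tilt s (v x) g)).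
  rewrite (sum_Idx (fun J _ => gauss_tilt s (batch_mean m h J) g -
    gauss_tilt s (batch_mean m h' J) g)).
  under [X in _ = _ * (_ * X)]eq_bigr do rewrite sumr_const card_ord -mulr_natl.
  rewrite -mulr_sumr card_Idx /batch_density -mulrBr -sumrB.
  rewrite [in LHS](bigID [pred S : {set 'I_n} | i \in S])/= [X in _ * (_ + X)]big1 ?addr0.
    by field; rewrite !gt_eqF.
  move=> S /andP[_ iS]; rewrite (_ : batch_mean m h S = batch_mean m h' S) ?subrr//.
  congr (_ *: _); apply: eq_bigr => b bS; apply: hh'.
  by apply: contraNneq iS => <-.
move=> /(_ QE PQE a a1) /le_trans; apply; rewrite lee_fin /rdp_factor.
rewrite mul1r -/(eps_j C s m 2) lerD2l big_nat_cond [leRHS]big_nat_cond.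
apply: ler_sum => j /andP[/andP[j3 _] _].
have jE : j.-1.+1 = j by exact: ltn_predK j3.
by rewrite jE (_ : j%:R - 1 = j.-1%:R :> R)// -[in LHS]jE -natr1 addrK.
Qed.

End batch_density_moment.

(** * Divergence of two chains *)

Section radon_nikodym_density.
Context d (T : measurableType d) (R : realType) (mu nu : probability T R).
Hypothesis munu : mu `<< nu.

(** This version of the derivative is finite and nonnegative everywhere; it agrees almost everywhere
    with the one in [renyi_div]. *)
Definition rn_density : T -> R := fine \o Radon_Nikodym_SigmaFinite.f mu nu.

Lemma nnmeasurable_rn_density : nnmeasurable rn_density.
Proof.
split=> [|x]; last exact/fine_ge0/Radon_Nikodym_SigmaFinite.f_ge0.
apply: measurableT_comp => //.
by have /integrableP[] := Radon_Nikodym_SigmaFinite.f_integrable munu.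
Qed.

Lemma rn_densityE A : measurable A -> mu A = (\int[nu]_(x in A) (rn_density x)%:E)%E.
Proof.
move=> mA; rewrite (Radon_Nikodym_SigmaFinite.f_integral munu mA).
by apply: eq_integral => x _; rewrite fineK// Radon_Nikodym_SigmaFinite.f_fin_num.
Qed.

Lemma renyi_div_le (a : nat) (r : R) : (1 < a)%N -> 1 <= r ->
  (\int[nu]_x (rn_density x ^+ a)%:E <= r%:E)%E ->
  (renyi_div a%:R mu nu <= (ln r / (a%:R - 1))%:E)%E.
Proof.
move=> a1 r1 hr; rewrite /renyi_div; case: pselect => // munu'.
rewrite (_ : integral _ _ _ = \int[nu]_x (rn_density x ^+ a)%:E)%E; last first.
  apply: ae_eq_integral => //.
  - apply/measurable_EFinP; apply: (measurableT_comp (@measurable_powR R a%:R)).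
    by apply: measurableT_comp => //; exact/measurable_int/Radon_Nikodym_integrable.
  - by apply/measurable_EFinP; apply: measurable_funX; exact: nnmeasurable_rn_density.1.
  have := ae_eq_Radon_Nikodym_SigmaFinite munu measurableT.
  apply: filterS => x /(_ Logic.I) xE _; rewrite -xE powR_mulrn//.
  exact/fine_ge0/Radon_Nikodym_SigmaFinite.f_ge0.
have : (0 <= \int[nu]_x (rn_density x ^+ a)%:E)%E.
  by apply: integral_ge0 => x _; rewrite lee_fin exprn_ge0// nnmeasurable_rn_density.2.
move: hr; case: (integral _ _ _) => [i| |]//; rewrite !lee_fin => ir i0.
rewrite ler_wpM2r ?invr_ge0 ?subr_ge0 ?ler1n 1?ltnW//.
(* For a zero moment, [ln 0] is 0 by convention, and the bound holds because [1 <= r]. *)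
move: i0; rewrite le_eqVlt => /predU1P[<-|i0]; first by rewrite ln0// ln_ge0.
by rewrite ler_ln// posrE (lt_le_trans i0).
Qed.

End radon_nikodym_density.

(** As [b] is positive everywhere, a [nu]-null set has a [lam]-null preimage, over which [a]
    integrates to 0. *)
Lemma image_density_dominates d d' (X : measurableType d) (Y : measurableType d')
    (R : realType) (lam : {measure set X -> \bar R}) (mu nu : probability Y R)
    (g : X -> Y) (a b : X -> R) :
  measurable_fun setT g -> measurable_fun setT a -> measurable_fun setT b ->
  (forall x, 0 < b x) ->
  (forall A, measurable A -> mu A = \int[lam]_(x in g @^-1` A) (a x)%:E)%E ->
  (forall A, measurable A -> nu A = \int[lam]_(x in g @^-1` A) (b x)%:E)%E ->
  mu `<< nu.
Proof.
move=> mg ma mb b0 mu_a nu_b; apply/null_content_dominatesP => A mA.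
have mgA : measurable (g @^-1` A) by rewrite -[X in measurable X]setTI; exact: mg.
rewrite (mu_a _ mA) => nuA0.
have bA0 : (\int[lam]_(x in g @^-1` A) (b x)%:E = 0)%E by rewrite -nu_b.
apply: null_set_integral => //; first exact/measurable_funTS/measurable_EFinP.
have mbA : measurable_fun (g @^-1` A) (EFin \o b).
  exact/measurable_funTS/measurable_EFinP.
have : (\int[lam]_(x in g @^-1` A) `|(EFin \o b) x| = 0)%E.
  rewrite -[RHS]bA0; apply: eq_integral => x _.
  by rewrite gee0_abs// lee_fin ltW.
move=> /(ae_eq_integral_abs lam mgA mbA)[N [mN N0 DN]].
apply/eqP; rewrite eq_le measure_ge0 andbT -N0 le_measure ?inE//.
apply: subset_trans DN => x Ax /= /(_ Ax)/eqP.
by rewrite eqe gt_eqF.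
Qed.

Section prod_density.
Local Open Scope ereal_scope.
Context d d' (S : measurableType d) (V : measurableType d') (R : realType).
Variables (mu mu' : probability S R) (N : probability V R) (t : S -> R).
Hypothesis mt : nnmeasurable t.
Hypothesis mu_t : forall A, measurable A -> mu A = \int[mu']_(x in A) (t x)%:E.

Lemma ge0_integral_prod_density (F : S * V -> \bar R) :
  measurable_fun setT F -> (forall z, 0 <= F z) ->
  \int[mu \x N]_z F z = \int[mu' \x N]_z (F z * (t z.1)%:E).
Proof.
move=> mF F0; rewrite (fubini_tonelli1 (m1 := mu) (m2 := N) F)//.
rewrite (fubini_tonelli1 (m1 := mu') (m2 := N) (fun z => F z * (t z.1)%:E)); last 2 first.
- apply: emeasurable_funM => //; apply/measurable_EFinP.
  exact: (measurableT_comp mt.1 measurable_fst).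
- by move=> z; rewrite mule_ge0// lee_fin mt.2.
rewrite (ge0_integral_density (lam := mu') (g := id) (a := t)); last 6 first.
- exact: measurable_id.
- exact: mt.1.
- exact: mt.2.
- exact: mu_t.
- exact: measurable_fun_fubini_tonelli_F.
- by move=> x; exact: integral_ge0.
apply: eq_integral => x _; rewrite /fubini_F/= -ge0_integralZr//.
- exact: measurableT_comp mF (measurable_pair1 _).
- by rewrite lee_fin mt.2.
Qed.

End prod_density.

Lemma integral_in_indic d (T : measurableType d) (R : realType)
    (mu : {measure set T -> \bar R}) (D : set T) (f : T -> R) :
  (\int[mu]_(x in D) (f x)%:E = \int[mu]_x (\1_D x * f x)%:E)%E.
Proof.
rewrite integral_mkcond; apply: eq_integral => x _; rewrite patchE indicE.
by case: ifP => _; rewrite ?mul1r ?mul0r.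
Qed.

(** * Two chains driven by the same batches and noise *)

Section noisy_batch_chains.
Context {R : realType} {d} {Omega : measurableType d} (P : probability Omega R).
Context {dS} {S : measurableType dS} {n p : nat} (T : nat) (s C : R) (m : nat).
Variables (B : nat -> Omega -> {set 'I_n}) (gam : nat -> 'I_p -> Omega -> R).
Hypotheses (s0 : s != 0) (C0 : 0 <= C) (mn : (0 < m <= n)%N).
Hypothesis B_meas : forall k b, (k < T)%N -> measurable [set w | B k w = b].
Hypothesis B_unif : forall k b, (k < T)%N ->
  P [set w | B k w = b] = (if #|b| == m then 'C(n, m)%:R^-1 else 0)%:E.
Hypothesis gam_meas : forall k i, (k < T)%N -> measurable_fun setT (gam k i).
Hypothesis gam_gauss : forall k i, (k < T)%N -> forall A : set R, measurable A ->
  P (gam k i @^-1` A) = normal_prob 0 s A.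
Hypothesis indep : mutually_independent P (@noise_events R Omega _ p T B gam).
Variables (next : nat -> S * 'rV[R]_p -> S) (st0 : S).
Hypothesis mnext : forall k, measurable_fun setT (next k).

Local Notation N := (gauss_rV s p).

Definition batch_step (h : S -> 'I_n -> 'rV[R]_p) (k : nat) (b : {set 'I_n}) (st : S)
  (g : 'rV[R]_p) : S := next k (st, batch_mean m (h st) b + g).

Lemma measurable_batch_mean d' (X : measurableType d') (h : X -> 'I_n -> 'rV[R]_p)
    (b : {set 'I_n}) : (forall a, measurable_fun setT (h^~ a)) ->
  measurable_fun setT (fun x => batch_mean m (h x) b).
Proof.
move=> mh; apply/measurable_fun_rVP => i.
rewrite (_ : (fun _ => _) = fun x => m%:R^-1 *
    \sum_a (if a \in b then h x a ord0 i else 0)); last first.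
  by apply/funext => x; rewrite mxE summxE big_mkcond.
apply: measurable_funM => //; apply: measurable_sum => a.
by case: (a \in b); [move/measurable_fun_rVP: (mh a); exact|exact: measurable_cst].
Qed.

Lemma measurable_batch_step (h : S -> 'I_n -> 'rV[R]_p) k b :
  (forall a, measurable_fun setT (h^~ a)) ->
  measurable_fun setT (fun z : S * 'rV[R]_p => batch_step h k b z.1 z.2).
Proof.
move=> mh; apply: (measurableT_comp (mnext k)).
apply: measurable_fun_pair => //; apply/measurable_fun_rVP => i.
rewrite (_ : (fun _ => _) = fun z : S * 'rV[R]_p =>
   batch_mean m (h z.1) b ord0 i + z.2 ord0 i); last by apply/funext => z; rewrite mxE.
apply: measurable_funD.
  have /measurable_fun_rVP := measurableT_comp (measurable_batch_mean b mh)
    (@measurable_fst _ _ S 'rV[R]_p).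
  exact.
exact: (measurableT_comp (measurable_rV_coord i) measurable_snd).
Qed.

Lemma nnmeasurable_state_batch_density (h : S -> 'I_n -> 'rV[R]_p) :
  (forall a, measurable_fun setT (h^~ a)) ->
  nnmeasurable (fun z : S * 'rV[R]_p => batch_density s m (h z.1) z.2).
Proof.
move=> mh; split => [|z]; last exact/ltW/batch_density_gt0.
apply: measurable_funM => //; under eq_fun do rewrite big_mkcond/=.
apply: measurable_sum => b; case: (#|b| == m); last exact: measurable_cst.
apply: measurable_gauss_tilt => //.
exact: (measurableT_comp (measurable_batch_mean b mh) measurable_fst).
Qed.

(** For a fixed batch and state the noisy mean is a translated Gaussian, hence a tilt of [N];
    averaging the tilts over uniform batches gives [batch_density]. *)
Lemma batch_step_density (h : S -> 'I_n -> 'rV[R]_p) k (mu : probability S R) A : (k < T)%N ->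
  (forall a, measurable_fun setT (h^~ a)) -> measurable A ->
  (\sum_b P [set w | B k w = b] *
     (mu \x N) [set z | A (batch_step h k b z.1 z.2)] =
   \int[mu \x N]_(z in next k @^-1` A) (batch_density s m (h z.1) z.2)%:E)%E.
Proof.
move=> kT mh mA.
have mD : measurable (next k @^-1` A).
  by rewrite -[X in measurable X]setTI; exact: mnext.
pose c (b : {set 'I_n}) : R := if #|b| == m then 'C(n, m)%:R^-1 else 0.
have c0 b : 0 <= c b by rewrite /c; case: ifP => // _; rewrite invr_ge0.
have mtilt b : nnmeasurable (fun z : S * 'rV[R]_p =>
    gauss_tilt s (batch_mean m (h z.1) b) z.2).
  split=> [|z]; last exact/ltW/gauss_tilt_gt0.
  apply: measurable_gauss_tilt => //.
  exact: (measurableT_comp (measurable_batch_mean b mh) measurable_fst).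
have mind b : nnmeasurable (fun z : S * 'rV[R]_p =>
    \1_(next k @^-1` A) z * gauss_tilt s (batch_mean m (h z.1) b) z.2).
  split=> [|z]; last by rewrite mulr_ge0// (mtilt b).2.
  by apply: measurable_funM; [exact: measurable_indic|exact: (mtilt b).1].
have E b : ((mu \x N) [set z | A (batch_step h k b z.1 z.2)] = \int[mu \x N]_z
    (\1_(next k @^-1` A) z * gauss_tilt s (batch_mean m (h z.1) b) z.2)%:E)%E.
  pose Z := [set z : S * 'rV[R]_p | A (batch_step h k b z.1 z.2)].
  have mZ : measurable Z.
    by rewrite -[X in measurable X]setTI; exact: measurable_batch_step.
  have -> : ((mu \x N) Z = \int[mu \x N]_z (\1_Z z)%:E)%E.
    by rewrite integral_indic// setIT.
  rewrite (fubini_tonelli1 (m1 := mu) (m2 := N) (fun z => (\1_Z z)%:E)); last 2 first.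
  - by apply/measurable_EFinP; exact: measurable_indic.
  - by move=> z; rewrite lee_fin.
  rewrite (fubini_tonelli1 (m1 := mu) (m2 := N) (fun z => (_ * _)%:E)); last 2 first.
  - by apply/measurable_EFinP; exact: (mind b).1.
  - by move=> z; rewrite lee_fin (mind b).2.
  apply: eq_integral => x _; rewrite /fubini_F/=.
  (* The shift depends on the state [x], so the translation formula is applied in each fibre after
     Tonelli. *)
  have := @ge0_integral_gauss_translate R s p (batch_mean m (h x) b)
    (fun g => (\1_(next k @^-1` A) (x, g))%:E) s0.
  move=> <-; first by [].
  - apply/measurable_EFinP; apply: measurableT_comp (measurable_pair1 _).
    exact: measurable_indic.
  - by move=> g; rewrite lee_fin.
under eq_bigr do rewrite E B_unif// -/(c _) -nn_integralZ//.
rewrite -nn_integral_sum; last by move=> b; exact: nnmeasurableZ.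
rewrite [RHS]integral_in_indic; apply: eq_integral => z _; congr (_%:E).
rewrite /batch_density mulrCA mulr_sumr mulr_sumr [RHS]big_mkcond/=.
by apply: eq_bigr => b _; rewrite /c; case: ifP => _; rewrite ?mul0r ?mulr0// mulrCA.
Qed.

Variables (i : 'I_n) (h h' : S -> 'I_n -> 'rV[R]_p).
Hypotheses (mh : forall a, measurable_fun setT (h^~ a)).
Hypotheses (mh' : forall a, measurable_fun setT (h'^~ a)).
Hypotheses (hC : forall st a, l2norm (h st a) <= C).
Hypotheses (h'C : forall st a, l2norm (h' st a) <= C).
Hypothesis hh' : forall st a, a != i -> h st a = h' st a.
Variable (a : nat).
Hypothesis (a1 : (1 < a)%N).

Local Notation ch := (chain B gam (batch_step h) st0).
Local Notation ch' := (chain B gam (batch_step h') st0).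
Let K := rdp_factor C s n m a.

Let K0 : 0 <= K.
Proof.
rewrite -lee_fin; apply: le_trans
  (batch_density_moment_le s0 C0 mn (hC st0) (h'C st0) (hh' st0) a1).
by apply: integral_ge0 => g _; rewrite lee_fin divr_ge0 ?exprn_ge0// ltW// batch_density_gt0.
Qed.

(** The invariant carried along the iterations: relative density [t], with moment of order [a] at
    most [K ^+ k]. *)
Let density k (mu mu' : probability S R) := exists t : S -> R,
  [/\ nnmeasurable t,
      forall A, measurable A -> mu A = (\int[mu']_(x in A) (t x)%:E)%E &
      (\int[mu']_x (t x ^+ a)%:E <= (K ^+ k)%:E)%E].

(** The new laws are images under the same map [next k], so data processing compares them with their
    densities on the product of state and noise. There the moment factors: [t x ^+ a] times an inner
    integral bounded by [K]. *)
Let density_step k (mu mu' mu1 mu1' : probability S R) : density k mu mu' ->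
  (forall A, measurable A -> mu1 A =
    \int[mu \x N]_(z in next k @^-1` A) (batch_density s m (h z.1) z.2)%:E)%E ->
  (forall A, measurable A -> mu1' A =
    \int[mu' \x N]_(z in next k @^-1` A) (batch_density s m (h' z.1) z.2)%:E)%E ->
  density k.+1 mu1 mu1'.
Proof.
move=> [t [mt mu_t tK]] mu1E mu1'E.
have mP := nnmeasurable_state_batch_density mh.
have mQ := nnmeasurable_state_batch_density mh'.
have Q0 (z : S * 'rV[R]_p) : 0 < batch_density s m (h' z.1) z.2 by exact: batch_density_gt0.
pose tP (z : S * 'rV[R]_p) := t z.1 * batch_density s m (h z.1) z.2.
have mtP : nnmeasurable tP.
  split => [|z]; last by rewrite mulr_ge0// ?mt.2 ?mP.2.
  by apply: measurable_funM; [exact: (measurableT_comp mt.1 measurable_fst)|exact: mP.1].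
have mu1E' A : measurable A -> (mu1 A = \int[mu' \x N]_(z in next k @^-1` A) (tP z)%:E)%E.
  move=> mA; rewrite (mu1E _ mA) [LHS]integral_in_indic [RHS]integral_in_indic.
  have mD : measurable (next k @^-1` A).
    by rewrite -[X in measurable X]setTI; exact: mnext.
  rewrite (ge0_integral_prod_density N mt mu_t); last 2 first.
  - by apply/measurable_EFinP/measurable_funM; [exact: measurable_indic|exact: mP.1].
  - by move=> z; rewrite lee_fin mulr_ge0// mP.2.
  by apply: eq_integral => z _; rewrite -EFinM /tP; congr (_%:E); ring.
have dom := image_density_dominates (mnext k) mtP.1 mQ.1 Q0 mu1E' mu1'E.
exists (rn_density mu1 mu1'); split; first exact: nnmeasurable_rn_density.
  by move=> A; exact: rn_densityE.
have aE : a = a.-1.+1 by rewrite prednK// ltnW.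
rewrite aE; apply: le_trans.
  apply: (density_moment_le (mnext k) mtP.1 mQ.1 (nnmeasurable_rn_density dom).1
    mtP.2 Q0 (nnmeasurable_rn_density dom).2 mu1E' mu1'E (rn_densityE dom)).
have mratio : nnmeasurable (fun z : S * 'rV[R]_p =>
    tP z ^+ a.-1.+1 / batch_density s m (h' z.1) z.2 ^+ a.-1).
  exact: nnmeasurable_pow_ratio mtP mQ.1 Q0.
rewrite (fubini_tonelli1 (m1 := mu') (m2 := N) (fun z => (_ / _)%:E)); last 2 first.
- by apply/measurable_EFinP; exact: mratio.1.
- by move=> z; rewrite lee_fin mratio.2.
apply: (@le_trans _ _ (\int[mu']_x (K * t x ^+ a)%:E)%E); last first.
  rewrite nn_integralZ//; last first.
    by split=> [|x]; [exact/measurable_funX/mt.1|rewrite exprn_ge0// mt.2].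
  by rewrite exprS EFinM lee_wpmul2l// lee_fin.
apply: ge0_le_integral => //.
- by move=> x _; apply: integral_ge0 => g _; rewrite lee_fin mratio.2.
- apply: (measurable_fun_fubini_tonelli_F (m2 := N)).
  + by apply/measurable_EFinP; exact: mratio.1.
  + by move=> z; rewrite lee_fin mratio.2.
- by apply/measurable_EFinP; apply: measurable_funM => //; exact/measurable_funX/mt.1.
move=> x _; rewrite /fubini_F/=.
have := batch_density_moment_le s0 C0 mn (hC x) (h'C x) (hh' x) a1.
have ta0 : 0 <= t x ^+ a by rewrite exprn_ge0// mt.2.
move=> /(lee_wpmul2l (_ : (0 <= (t x ^+ a)%:E)%E)); rewrite lee_fin => /(_ ta0).
have mPQ : nnmeasurable (fun g =>
    batch_density s m (h x) g ^+ a.-1.+1 / batch_density s m (h' x) g ^+ a.-1).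
  apply: nnmeasurable_pow_ratio => [||g].
  - exact: nnmeasurable_batch_density.
  - exact: (nnmeasurable_batch_density _ _ _).1.
  - exact: batch_density_gt0.
rewrite -aE in mPQ; rewrite -nn_integralZ//.
rewrite -EFinM mulrC; apply: le_trans.
rewrite le_eqVlt; apply/orP; left; apply/eqP; apply: eq_integral => y _.
by congr (_%:E); rewrite -aE /tP exprMn -mulrA.
Qed.

Lemma noisy_batch_chain_density k (kT : (k <= T)%N) (mu mu' : probability S R) :
  (forall A, measurable A -> mu A = P (ch k @^-1` A)) ->
  (forall A, measurable A -> mu' A = P (ch' k @^-1` A)) ->
  density k mu mu'.
Proof.
have mst g (mg : forall a, measurable_fun setT (g^~ a)) j b :=
  measurable_batch_step j b mg.
elim: k kT mu mu' => [_|k IH kT] mu mu' muE mu'E.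
  (* Both chains start at [st0], so the two initial laws coincide. *)
  exists (fun=> 1); split; first by split => // x; exact: ler01.
    move=> A mA; apply: (etrans (muE _ mA)).
    apply: (etrans _ (esym (integral_cst mu' mA 1%E))).
    by rewrite mul1e; exact/esym/mu'E.
  under eq_integral do rewrite expr1n.
  by rewrite integral_cst// mul1e expr0 probability_le1.
pose nu := law P (measurable_chain B_meas gam_meas st0 (mst _ mh) (ltnW kT)).
pose nu' := law P (measurable_chain B_meas gam_meas st0 (mst _ mh') (ltnW kT)).
apply: (density_step (IH (ltnW kT) nu nu' (fun _ _ => erefl) (fun _ _ => erefl))) => A mA.
  rewrite muE// (chain_law_step B_meas gam_meas gam_gauss indep (mst _ mh) (mu := nu))//.
  exact: batch_step_density.
rewrite mu'E// (chain_law_step B_meas gam_meas gam_gauss indep (mst _ mh') (mu := nu'))//.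
exact: batch_step_density.
Qed.

(** Releasing only [out] of the final state is one more application of data processing, now with
    reference law [nu'] and second density 1. *)
Lemma noisy_batch_chain_renyi_div d' (Out : measurableType d') (out : S -> Out)
    (mu mu' : probability Out R) : measurable_fun setT out -> 1 <= K ->
  (forall A, measurable A -> mu A = P ((out \o ch T) @^-1` A)) ->
  (forall A, measurable A -> mu' A = P ((out \o ch' T) @^-1` A)) ->
  (renyi_div a%:R mu mu' <= (ln (K ^+ T) / (a%:R - 1))%:E)%E.
Proof.
move=> mout K1 muE mu'E.
have mst g (mg : forall a, measurable_fun setT (g^~ a)) j b :=
  measurable_batch_step j b mg.
pose nu := law P (measurable_chain B_meas gam_meas st0 (mst _ mh) (leqnn T)).
pose nu' := law P (measurable_chain B_meas gam_meas st0 (mst _ mh') (leqnn T)).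
have [t [mt nut tK]] : density T nu nu'.
  by apply: noisy_batch_chain_density => // A _; exact: lawE.
have mout' A : measurable A -> measurable (out @^-1` A).
  by move=> mA; rewrite -[X in measurable X]setTI; exact: mout.
have muE' A : measurable A -> (mu A = \int[nu']_(x in out @^-1` A) (t x)%:E)%E.
  by move=> mA; rewrite muE// -nut//; exact: mout'.
have mu'E' A : measurable A -> (mu' A = \int[nu']_(x in out @^-1` A) (1 : R)%:E)%E.
  by move=> mA; rewrite integral_cst ?mul1e ?mu'E//; exact: mout'.
have dom := image_density_dominates mout mt.1 (measurable_cst (1 : R))
  (fun=> ltr01) muE' mu'E'.
apply: renyi_div_le => //; first exact: exprn_ege1.
have aE : a = a.-1.+1 by rewrite prednK// ltnW.
apply: le_trans tK; rewrite aE.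
have := density_moment_le mout mt.1 (measurable_cst (1 : R)) (nnmeasurable_rn_density dom).1
    mt.2 (fun=> ltr01) (nnmeasurable_rn_density dom).2 muE' mu'E' (rn_densityE dom) a.-1.
move=> /le_trans; apply; apply: ge0_le_integral => //.
- by move=> x _; rewrite lee_fin divr_ge0 ?exprn_ge0// mt.2.
- apply/measurable_EFinP.
  exact: (nnmeasurable_pow_ratio _ mt (measurable_cst (1 : R)) (fun=> ltr01)).1.
- by apply/measurable_EFinP; exact/measurable_funX/mt.1.
- by move=> x _; rewrite lee_fin expr1n divr1.
Qed.

End noisy_batch_chains.

(** * The ssADMM chain *)

Lemma rdp_factor_ge1 (R : realType) (C s : R) (n m a : nat) : 1 <= rdp_factor C s n m a.
Proof.
have e0 j : 0 <= eps_j C s m j.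
  by rewrite /eps_j divr_ge0// mulr_ge0 ?sqr_ge0.
have q0 : 0 <= m%:R / n%:R :> R by rewrite divr_ge0.
rewrite /rdp_factor -addrA lerDl addr_ge0//.
  rewrite mulr_ge0 ?exprn_ge0 ?mulr_ge0 ?exprn_ge0// le_min !mulr_ge0 ?expR_ge0//.
  by rewrite subr_ge0 -expR0 ler_expR.
by apply: sumr_ge0 => j _; rewrite !mulr_ge0 ?exprn_ge0 ?expR_ge0.
Qed.

Section measurable_rV_ops.
Context {R : realType} {p : nat} d (X : measurableType d).
Implicit Types u v : X -> 'rV[R]_p.

Lemma measurable_rVD u v : measurable_fun setT u -> measurable_fun setT v ->
  measurable_fun setT (fun x => u x + v x).
Proof.
move=> /measurable_fun_rVP mu /measurable_fun_rVP mv; apply/measurable_fun_rVP => i.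
rewrite (_ : (fun _ => _) = fun x => u x ord0 i + v x ord0 i).
  exact: measurable_funD.
by apply/funext => x; rewrite mxE.
Qed.

Lemma measurable_rVZ (c : R) u : measurable_fun setT u ->
  measurable_fun setT (fun x => c *: u x).
Proof.
move=> /measurable_fun_rVP mu; apply/measurable_fun_rVP => i.
rewrite (_ : (fun _ => _) = fun x => c * u x ord0 i).
  exact: measurable_funM.
by apply/funext => x; rewrite mxE.
Qed.

Lemma measurable_rVN u : measurable_fun setT u -> measurable_fun setT (fun x => - u x).
Proof.
move=> mu; rewrite (_ : (fun _ => _) = fun x => -1 *: u x); first exact: measurable_rVZ.
by apply/funext => x; rewrite scaleN1r.
Qed.

(** For [t >= 0] the case distinction is a sum of a maximum and a minimum, from which measurability
    is immediate. *)
Lemma soft_threshold_coordE (t : R) (w : 'rV[R]_p) i : 0 <= t ->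
  soft_threshold t w ord0 i = Num.max (w ord0 i - t) 0 + Num.min (w ord0 i + t) 0.
Proof.
move=> t0; rewrite mxE; case: (ltP t (w ord0 i)) => h1.
  rewrite max_l ?min_r ?addr0//; last by rewrite subr_ge0 ltW.
  by rewrite addr_ge0// (le_trans t0)// ltW.
rewrite (max_r (x := _ - t)) ?subr_le0// add0r.
case: (ltP (w ord0 i) (- t)) => h2; first by rewrite min_l// -lerBrDr sub0r ltW.
by rewrite min_r// -lerBlDr sub0r.
Qed.

Lemma measurable_soft_threshold (t : R) u : 0 <= t -> measurable_fun setT u ->
  measurable_fun setT (fun x => soft_threshold t (u x)).
Proof.
move=> t0 /measurable_fun_rVP mu; apply/measurable_fun_rVP => i.
rewrite (_ : (fun _ => _) = fun x =>
  Num.max (u x ord0 i - t) 0 + Num.min (u x ord0 i + t) 0); last first.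
  by apply/funext => x; rewrite soft_threshold_coordE.
apply: measurable_funD.
  by apply: measurable_maxr => //; exact: measurable_funB.
by apply: measurable_minr => //; exact: measurable_funD.
Qed.

End measurable_rV_ops.

Section ssadmm_chain.
Context {R : realType} {Dom : Type} {n p : nat}.
Variables (f : 'rV[R]_p -> Dom -> R) (lam rho : R) (m : nat) (eta : nat -> R).
Local Notation S := ('rV[R]_p * 'rV[R]_p * 'rV[R]_p)%type.

(* [q.2] is the noisy gradient, so that this map does not involve the dataset. *)
Definition ssadmm_next (k : nat) (q : S * 'rV[R]_p) : S :=
  let x' := (rho + (eta k)^-1)^-1 *:
    (- q.2 - q.1.2 + rho *: q.1.1.2 + (eta k)^-1 *: q.1.1.1) in
  let z' := soft_threshold (lam / rho) (x' + rho^-1 *: q.1.2) in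
  (x', z', q.1.2 + rho *: (x' - z')).

Definition record_gradient (D : 'I_n -> Dom) (st : S) (a : 'I_n) : 'rV[R]_p :=
  gradient (f ^~ (D a)) st.1.1.

Lemma ssadmm_stateE (D : 'I_n -> Dom) (x0 z0 y0 : 'rV[R]_p)
    d (Omega : measurableType d)
    (B : nat -> Omega -> {set 'I_n}) (gam : nat -> 'I_p -> Omega -> R) k w :
  ssadmm_state f lam rho m eta D x0 z0 y0 (fun k => B k w)
    (fun k => \row_(i < p) gam k i w) k =
  chain B gam (batch_step m ssadmm_next (record_gradient D)) (x0, z0, y0) k w.
Proof. by elim: k => //= k ->; case: (chain _ _ _ _ k w) => [[x z] y]. Qed.

Lemma measurable_ssadmm_next k : 0 <= lam / rho -> measurable_fun setT (ssadmm_next k).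
Proof.
move=> t0.
have m1 : measurable_fun setT (fun q : S * 'rV[R]_p => q.1) by exact: measurable_fst.
have m2 : measurable_fun setT (fun q : S * 'rV[R]_p => q.2) by exact: measurable_snd.
have m12 : measurable_fun setT (fun q : S * 'rV[R]_p => q.1.2).
  exact: (measurableT_comp measurable_snd m1).
have m11 : measurable_fun setT (fun q : S * 'rV[R]_p => q.1.1).
  exact: (measurableT_comp measurable_fst m1).
have m111 : measurable_fun setT (fun q : S * 'rV[R]_p => q.1.1.1).
  exact: (measurableT_comp measurable_fst m11).
have m112 : measurable_fun setT (fun q : S * 'rV[R]_p => q.1.1.2).
  exact: (measurableT_comp measurable_snd m11).
have mx : measurable_fun setT (fun q => (ssadmm_next k q).1.1).
  apply: measurable_rVZ; apply: measurable_rVD; last exact: measurable_rVZ.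
  apply: measurable_rVD; last exact: measurable_rVZ.
  by apply: measurable_rVD; exact: measurable_rVN.
have mz : measurable_fun setT (fun q => (ssadmm_next k q).1.2).
  apply: measurable_soft_threshold => //; apply: measurable_rVD => //.
  exact: measurable_rVZ.
apply: measurable_fun_pair; first exact: measurable_fun_pair.
apply: measurable_rVD => //; apply: measurable_rVZ; apply: measurable_rVD => //.
exact: measurable_rVN.
Qed.

Lemma measurable_record_gradient (D : 'I_n -> Dom) a :
  (forall dd, continuous (gradient (f ^~ dd))) ->
  measurable_fun setT ((record_gradient D)^~ a).
Proof.
move=> fC1; apply/measurable_fun_rVP => i.
have mg : measurable_fun setT (fun x => gradient (f ^~ (D a)) x ord0 i).
  apply: measurable_fun_continuous_rV => x.
  apply: (@continuous_comp _ _ _ (gradient (f ^~ (D a))) (fun v : 'rV[R]_p => v ord0 i)).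
    exact: fC1.
  exact: coord_continuous.
apply: (measurableT_comp mg).
exact: (measurableT_comp measurable_fst measurable_fst).
Qed.

End ssadmm_chain.

Unset Implicit Arguments.
Set Strict Implicit.

Theorem theorem1 (R : realType) (Dom : Type) (n p : nat)
  (f : 'rV[R]_p -> Dom -> R) (C : R) (C_gt0 : 0 < C)
  (f_convex : forall (dd : Dom) (x y : 'rV[R]_p) (t : R), 0 <= t <= 1 ->
     f ((1 - t) *: x + t *: y) dd <= (1 - t) * f x dd + t * f y dd)
  (f_diff : forall (dd : Dom) (x : 'rV[R]_p), differentiable (f ^~ dd) x)
  (f_C1 : forall dd : Dom, continuous (gradient (f ^~ dd)))
  (f_grad_bound : forall (dd : Dom) (x : 'rV[R]_p),
     l2norm (gradient (f ^~ dd) x) <= C)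
  (lam rho : R) (lam_gt0 : 0 < lam) (rho_gt0 : 0 < rho)
  (m : nat) (m_range : (1 <= m <= n)%N)
  (T : nat) (eta : nat -> R) (eta_gt0 : forall k, (k < T)%N -> 0 < eta k)
  (sigma : R) (sigma_gt0 : 0 < sigma)
  (x0 z0 y0 : 'rV[R]_p)
  (d : measure_display) (Omega : measurableType d) (P : probability Omega R)
  (B : nat -> Omega -> {set 'I_n}) (gam : nat -> 'I_p -> Omega -> R)
  (B_meas : forall (k : nat) (S : {set 'I_n}), (k < T)%N ->
     measurable [set w | B k w = S])
  (B_unif : forall (k : nat) (S : {set 'I_n}), (k < T)%N ->
     P [set w | B k w = S] = (if #|S| == m then ('C(n, m)%:R)^-1 else 0)%:E)
  (gam_meas : forall (k : nat) (i : 'I_p), (k < T)%N ->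
     measurable_fun [set: Omega] (gam k i))
  (gam_gauss : forall (k : nat) (i : 'I_p), (k < T)%N ->
     forall A : set R, measurable A ->
       P (gam k i @^-1` A) = normal_prob 0 sigma A)
  (indep : mutually_independent P
     (fun j : 'I_T + ('I_T * 'I_p) =>
        match j with
        | inl k => [set E | exists SS : set {set 'I_n}, E = B k @^-1` SS]
        | inr (k, i) => [set E | exists A : set R,
                           measurable A /\ E = gam k i @^-1` A]
        end)) :
  forall alpha : nat, (2 <= alpha)%N ->
    rdp P
      (fun (D : 'I_n -> Dom) (w : Omega) =>
         rV_to_tuple (ssadmm_output f lam rho m eta D x0 z0 y0
                        (fun k => B k w) (fun k => \row_(i < p) gam k i w) T))
      alpha%:R (T%:R * eps_prime C sigma n m alpha).
Proof.
move=> alpha alpha2 D D' [i DD'] mu mu' muE mu'E.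
have alpha1 : 0 < (alpha%:R - 1 : R) by rewrite subr_gt0 ltr1n.
have s0 : sigma != 0 by rewrite gt_eqF.
have t0 : 0 <= lam / rho by rewrite divr_ge0// ltW.
(* The budgets of [T] iterations add up as the logarithm of the [T]-th power of the one-step
   factor. *)
have -> : T%:R * eps_prime C sigma n m alpha =
    ln (rdp_factor C sigma n m alpha ^+ T) / (alpha%:R - 1).
  rewrite lnXn; last exact: lt_le_trans ltr01 (rdp_factor_ge1 _ _ _ _ _).
  by rewrite -(mulr_natl (ln _)) -mulrA; congr (_ * _); exact: mulrC.
have mout : measurable_fun setT
    (fun st : 'rV[R]_p * 'rV[R]_p * 'rV[R]_p => rV_to_tuple st.1.1).
  apply: (measurableT_comp measurable_rV_to_tuple).
  exact: (measurableT_comp measurable_fst measurable_fst).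
apply: (noisy_batch_chain_renyi_div (st0 := (x0, z0, y0)) (next := ssadmm_next lam rho eta)
  s0 (ltW C_gt0) m_range B_meas B_unif gam_meas gam_gauss indep _
  (i := i) (h := record_gradient f D) (h' := record_gradient f D')
  _ _ _ _ _ alpha2 mout (rdp_factor_ge1 _ _ _ _ _)).
- by move=> k; exact: measurable_ssadmm_next.
- by move=> a; exact: measurable_record_gradient.
- by move=> a; exact: measurable_record_gradient.
- by move=> st a; exact: f_grad_bound.
- by move=> st a; exact: f_grad_bound.
- by move=> st a /DD' Da; rewrite /record_gradient Da.
- move=> A mA; rewrite muE//; congr (P _); apply/funext => w /=.
  by rewrite /ssadmm_output ssadmm_stateE.
- move=> A mA; rewrite mu'E//; congr (P _); apply/funext => w /=.
  by rewrite /ssadmm_output ssadmm_stateE.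
Qed.
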